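(* Let $H$ be a cancellative monoid and let $r$ be an ideal system on $H$ such that $H$ is $r$-noetherian. \begin{enumerate} \item If the monoid $(\mathcal I_r^*(H),\cdot_r)$ has a prime element, and if $\mathcal I_r^*(H)$ either has accepted elasticity or is locally finitely generated, then $\mathcal I_r^*(H)$ is fully elastic. \item Suppose that $H$ has finite $r$-character and satisfies the $r$-Krull Intersection Theorem. If $H$ has an $r$-invertible prime $r$-ideal, and if either $\mathcal I_r(H)$ has accepted elasticity or every divisor-closed submonoid of $\mathcal I_r(H)$ generated by one element has accepted elasticity, then $(\mathcal I_r(H),\cdot_r)$ is fully elastic. \end{enumerate}
   Context: An ideal system on a cancellative commutative monoid $H$ (with quotient group $\mathsf q(H)$) is a map $X\mapsto X_r$ on subsets of $H$ such that for all $X,Y\subseteq H$ and $a\in H$: $X\subseteq X_r$; $X\subseteq Y_r$ implies $X_r\subseteq Y_r$; $aH\subseteq\{a\}_r$; $aX_r=(aX)_r$. An $r$-ideal is a subset $I$ with $I_r=I$; $\mathcal I_r(H)$ is the set of nonempty $r$-ideals with $r$-multiplication $I\cdot_r J=(IJ)_r$. $r$ extends to fractional ideals (subsets $X\subseteq\mathsf q(H)$ with $cX\subseteq H$ for some $c\in H$) by $X_r=c^{-1}(cX)_r$; an $r$-ideal $I$ is $r$-invertible if $(IJ)_r=H$ for some fractional $r$-ideal $J$. $\mathcal I_r^*(H)\subseteq\mathcal I_r(H)$ is the cancellative monoid of $r$-invertible $r$-ideals. $H$ is $r$-noetherian if it satisfies the ACC on $r$-ideals; it has finite $r$-character if every element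 of $H$ lies in only finitely many maximal $r$-ideals; it satisfies the $r$-Krull Intersection Theorem if $\bigcap_{n\ge0}(I^n)_r=\emptyset$ for all $I\in\mathcal I_r(H)\setminus\{H\}$. A prime $r$-ideal is an $r$-ideal $P\neq H$ with $ab\in P\Rightarrow a\in P$ or $b\in P$. Arithmetic notions (for a commutative unit-cancellative semigroup $M$ with identity): atoms, $\mathsf L(a)$ = set of $\ell$ with $a=\varepsilon u_1\cdots u_\ell$ ($\varepsilon$ a unit, $u_i$ atoms), $\mathcal L(M)=\{\mathsf L(a)\}$; $\rho(L)=\max L/\min L$, $\rho(\{0\})=1$, $\rho(M)=\sup_{L\in\mathcal L(M)}\rho(L)$; accepted elasticity: $\rho(L)=\rho(M)$ for some $L\in\mathcal L(M)$; fully elastic: every rational $q$ with $1<q<\rho(M)$ equals $\rho(L)$ for some $L\in\mathcal L(M)$. A prime element $p$ is a non-unit with $p\mid ab\Rightarrow p\mid a$ or $p\mid b$. For $a\in M$, the divisor-closed submonoid generated by $a$ is the set of all divisors in $M$ of powers of $a$; $M$ is locally finitely generated if for every $a$ this submonoid modulo units is finitely generated. *)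

(* Defs.v *)
From Stdlib Require Import Reals QArith List ClassicalEpsilon.
From Coquelicot Require Import Coquelicot.
Set Implicit Arguments.
Unset Strict Implicit.

Record CGroup := {
  gcar :> Type;
  gmul : gcar -> gcar -> gcar;
  ginv : gcar -> gcar;
  gone : gcar;
  gmulA : forall x y z, gmul x (gmul y z) = gmul (gmul x y) z;
  gmulC : forall x y, gmul x y = gmul y x;
  gmul1 : forall x, gmul gone x = x;
  gmulV : forall x, gmul (ginv x) x = gone }.

Arguments gmul {c}. Arguments ginv {c}. Arguments gone {c}.

(* H : G -> Prop is a (cancellative commutative) monoid whose quotient group is G:
   H is a submonoid of the abelian group G and every element of G is a/b, a,b in H. *)
Definition quotient_group_of (G : CGroup) (H : G -> Prop) : Prop :=
  H gone /\ (forall a b, H a -> H b -> H (gmul a b)) /\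
  (forall g : G, exists a b, H a /\ H b /\ g = gmul a (ginv b)).

Definition subset (G : Type) (X Y : G -> Prop) : Prop := forall x, X x -> Y x.
Definition setmul (G : CGroup) (X Y : G -> Prop) : G -> Prop :=
  fun g => exists x y, X x /\ Y y /\ g = gmul x y.
Definition sing (G : Type) (a : G) : G -> Prop := fun g => g = a.
Definition smul (G : CGroup) (a : G) (X : G -> Prop) : G -> Prop := setmul (sing a) X.
Definition nonempty (G : Type) (X : G -> Prop) : Prop := exists x, X x.
Definition setinter (G : Type) (F : nat -> G -> Prop) : G -> Prop := fun g => forall n, F n g.

Definition ideal_system (G : CGroup) (H : G -> Prop) (r : (G -> Prop) -> (G -> Prop)) : Prop :=
  (forall X, subset X H -> subset (r X) H) /\
  (forall X, subset X H -> subset X (r X)) /\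
  (forall X Y, subset X H -> subset Y H -> subset X (r Y) -> subset (r X) (r Y)) /\
  (forall a, H a -> subset (smul a H) (r (sing a))) /\
  (forall a X, H a -> subset X H -> smul a (r X) = r (smul a X)).

Definition r_ideal (G : CGroup) (H : G -> Prop) r (I : G -> Prop) : Prop :=
  subset I H /\ r I = I.

Definition Ir (G : CGroup) (H : G -> Prop) r (I : G -> Prop) : Prop :=
  r_ideal H r I /\ nonempty I.

Definition rmul (G : CGroup) (r : (G -> Prop) -> (G -> Prop)) (I J : G -> Prop) : G -> Prop :=
  r (setmul I J).

(* fractional ideals and the extension of r to them: X_r = c^{-1} (cX)_r *)
Definition fractional (G : CGroup) (H : G -> Prop) (X : G -> Prop) : Prop :=
  exists c, H c /\ subset (smul c X) H.
Definition rfrac (G : CGroup) (H : G -> Prop) r (X : G -> Prop) : G -> Prop :=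
  fun g => exists c, H c /\ subset (smul c X) H /\ smul (ginv c) (r (smul c X)) g.

Definition r_invertible (G : CGroup) (H : G -> Prop) r (I : G -> Prop) : Prop :=
  Ir H r I /\
  exists J, fractional H J /\ rfrac H r J = J /\ rfrac H r (setmul I J) = H.

Definition Irstar (G : CGroup) (H : G -> Prop) r (I : G -> Prop) : Prop := r_invertible H r I.

Definition r_noetherian (G : CGroup) (H : G -> Prop) r : Prop :=
  forall I : nat -> G -> Prop, (forall n, r_ideal H r (I n)) ->
    (forall n, subset (I n) (I (S n))) -> exists N : nat, forall n : nat, (N <= n)%nat -> I n = I N.

Definition maximal_r_ideal (G : CGroup) (H : G -> Prop) r (M : G -> Prop) : Prop :=
  r_ideal H r M /\ M <> H /\
  forall J, r_ideal H r J -> J <> H -> subset M J -> J = M.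

Definition finite_r_character (G : CGroup) (H : G -> Prop) r : Prop :=
  forall a, H a -> exists l : list (G -> Prop),
    forall M, maximal_r_ideal H r M -> M a -> In M l.

Fixpoint setpow (G : CGroup) (I : G -> Prop) (n : nat) : G -> Prop :=
  match n with O => sing gone | S k => setmul I (setpow I k) end.

Definition r_Krull_intersection (G : CGroup) (H : G -> Prop) r : Prop :=
  forall I, Ir H r I -> I <> H -> forall g, ~ setinter (fun n => r (setpow I n)) g.

Definition prime_r_ideal (G : CGroup) (H : G -> Prop) r (P : G -> Prop) : Prop :=
  r_ideal H r P /\ P <> H /\
  forall a b, H a -> H b -> P (gmul a b) -> P a \/ P b.

(* ---------- arithmetic of a commutative monoid given by a carrier predicate
   P on a type T, an operation op and an identity e ---------- *)
Section Arith.
Variables (T : Type) (P : T -> Prop) (op : T -> T -> T) (e : T).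

Definition is_unit (u : T) : Prop := P u /\ exists v, P v /\ op u v = e.
Definition divides (a b : T) : Prop := P a /\ P b /\ exists c, P c /\ b = op a c.
Definition is_atom (u : T) : Prop :=
  P u /\ ~ is_unit u /\ forall a b, P a -> P b -> u = op a b -> is_unit a \/ is_unit b.
Definition is_prime (p : T) : Prop :=
  P p /\ ~ is_unit p /\
  forall a b, P a -> P b -> divides p (op a b) -> divides p a \/ divides p b.

Definition prodl (l : list T) : T := fold_right op e l.
Fixpoint mpow (a : T) (n : nat) : T := match n with O => e | S k => op a (mpow a k) end.

Definition lengths (a : T) : nat -> Prop :=
  fun n => exists eps us, is_unit eps /\ List.Forall is_atom us /\ length us = n /\
                          a = op eps (prodl us).

Definition dc_sub (a : T) : T -> Prop := fun b => P b /\ exists n, divides b (mpow a n).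

Definition locally_fg : Prop :=
  forall a, P a -> exists gens : list T, List.Forall (dc_sub a) gens /\
    forall b, dc_sub a b -> exists eps us, is_unit eps /\ List.Forall (fun g => In g gens) us /\
                                      b = op eps (prodl us).
End Arith.

Definition rho (L : nat -> Prop) : Rbar :=
  if excluded_middle_informative (forall n, L n <-> n = 0%nat) then Finite 1
  else Rbar_div (Rbar_lub (fun x => exists n, L n /\ x = Finite (INR n)))
                (Rbar_glb (fun x => exists n, L n /\ x = Finite (INR n))).

Definition elasticity (T : Type) (P : T -> Prop) (op : T -> T -> T) (e : T) : Rbar :=
  Rbar_lub (fun x => exists a, P a /\ x = rho (lengths P op e a)).

Definition accepted_elasticity (T : Type) (P : T -> Prop) (op : T -> T -> T) (e : T) : Prop :=
  exists a, P a /\ rho (lengths P op e a) = elasticity P op e.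

Definition fully_elastic (T : Type) (P : T -> Prop) (op : T -> T -> T) (e : T) : Prop :=
  forall q : Q, Rbar_lt (Finite 1) (Finite (Q2R q)) ->
    Rbar_lt (Finite (Q2R q)) (elasticity P op e) ->
    exists a, P a /\ rho (lengths P op e a) = Finite (Q2R q).

(* Main.v *)
(* Both monoids of ideals are reduced.  If [p] is a cancellative prime element, then
   [L (p^k b^N) = k + L (b^N)]; and if [L b] realizes the elasticity of a divisor-closed submonoid
   containing [b], then [max L (b^N) = N max (L b)] and [min L (b^N) = N min (L b)], so suitable
   [k] and [N] produce every rational number between [1] and the elasticity.

   This needs finite sets of lengths.  In [I_r(H)] they come from finite [r]-character and the
   Krull intersection property.  The cancellative monoid [I_r^*(H)] is [v]-noetherian because [H]
   is [r]-noetherian, and [v]-noetherian monoids have bounded factorizations.  In the locally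
   finitely generated case, Dickson's lemma shows that the maximal quotient of two factorization
   lengths is attained. *)
Require Import Defs.
From Stdlib Require Import Reals QArith.
From Coquelicot Require Import Coquelicot.
From Stdlib Require Import ClassicalEpsilon FunctionalExtensionality PropExtensionality.
From Stdlib Require Import ZArith Arith List Permutation Lia Lra.

(** * Elasticity and prime elements *)

(** The equation [(k + N m) / (k + N n) = s / t] reads [k (s - t) = N (m t - s n)]. It is solved by
    [N = s - t] and [k = m t - s n], which are natural numbers because [1 < s / t < m / n]. What is
    asked of [b] is a pair of lengths [m], [n] such that no power of [b] has two lengths in a larger
    ratio. Accepted elasticity alone does not give such a pair: the accepted value might be [+oo],
    coming from an infinite set of lengths. The two monoids of ideals need different finiteness
    arguments. Among invertible ideals inclusion is divisibility, so the chain condition on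
    [r]-ideals controls divisibility in [Irstar]. In [Ir] a divisor contains its multiples but the
    converse may fail, so factors are counted inside maximal [r]-ideals instead. *)

Lemma nat_min (S : nat -> Prop) k : S k -> exists n, S n /\ forall j, S j -> (n <= j)%nat.
Proof.
  induction k as [k IH] using (well_founded_induction lt_wf). intros hk.
  destruct (classic (exists j, S j /\ (j < k)%nat)) as [(j & hj & hlt)|h].
  - now apply (IH j).
  - exists k. split; auto. intros j hj. apply Nat.nlt_ge. intros hlt. apply h. now exists j.
Qed.

Lemma nat_max (S : nat -> Prop) k B :
  S k -> (forall j, S j -> (j <= B)%nat) -> exists m, S m /\ forall j, S j -> (j <= m)%nat.
Proof.
  intros hk hB.
  destruct (nat_min (fun d => S (B - d)%nat) (B - k)%nat) as (d & hd & hmin).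
  { replace (B - (B - k))%nat with k; auto. specialize (hB k hk). lia. }
  exists (B - d)%nat. split; auto. intros j hj. specialize (hB j hj).
  specialize (hmin (B - j)%nat). replace (B - (B - j))%nat with j in hmin by lia.
  specialize (hmin hj). lia.
Qed.

Lemma rho_unfold (S : nat -> Prop) k :
  ~ S 0%nat -> S k ->
  rho S = Rbar_div (Rbar_lub (fun x => exists n, S n /\ x = Finite (INR n)))
                   (Rbar_glb (fun x => exists n, S n /\ x = Finite (INR n))).
Proof.
  intros h0 hk. unfold rho. destruct (excluded_middle_informative _) as [h|h]; auto.
  now destruct h0; apply h.
Qed.

Lemma rho_ge (S : nat -> Prop) m n :
  ~ S 0%nat -> S m -> S n -> Rbar_le (Finite (INR m / INR n)) (rho S).
Proof.
  intros h0 hm hn. rewrite (rho_unfold S m) by auto. unfold Rbar_lub, Rbar_glb.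
  destruct (Rbar_ex_lub _) as (l & hl & hl'). destruct (Rbar_ex_glb _) as (g & hg & hg').
  simpl.
  assert (hl1 : Rbar_le (INR m) l) by (apply hl; eauto).
  assert (hg1 : Rbar_le g (INR n)) by (apply hg; eauto).
  (* Since 0 is not in [S], the infimum is at least 1, and its inverse is a genuine positive real;
     only the supremum may be infinite. *)
  assert (hg2 : Rbar_le 1 g).
  { apply hg'. intros x (k & hk & ->). simpl. apply (le_INR 1).
    destruct k; [easy|lia]. }
  destruct g as [g| |]; simpl in hg1, hg2; try easy.
  assert (hinv : (/ INR n <= / g)%R) by (apply Rinv_le_contravar; lra).
  assert (hpos : (0 < / g)%R) by (apply Rinv_0_lt_compat; lra).
  destruct l as [l| |]; simpl in hl1; try easy.
  - simpl. apply Rmult_le_compat; auto. apply pos_INR.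
    left. apply Rinv_0_lt_compat. lra.
  - unfold Rbar_div, Rbar_inv, Rbar_mult, Rbar_mult'. destruct (Rle_dec 0 (/ g)); [|lra].
    destruct (Rle_lt_or_eq_dec _ _ _); [easy|lra].
Qed.

Lemma rho_eq (S : nat -> Prop) m n :
  ~ S 0%nat -> S m -> S n -> (forall j, S j -> (n <= j <= m)%nat) ->
  rho S = Finite (INR m / INR n).
Proof.
  intros h0 hm hn h. rewrite (rho_unfold S m) by auto.
  rewrite (Rbar_is_lub_unique _ (Finite (INR m))), (Rbar_is_glb_unique _ (Finite (INR n))).
  - reflexivity.
  - split; [|intros b hb; apply hb; eauto]. intros x (j & hj & ->). apply le_INR, h, hj.
  - split; [|intros b hb; apply hb; eauto]. intros x (j & hj & ->). apply le_INR, h, hj.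
Qed.

(** The conventions of [Rbar] give [-oo / +oo = -oo * 0 = 0], so an element without factorizations
    never has [rho] above 1. *)
Lemma rho_empty (S : nat -> Prop) : (forall n, ~ S n) -> rho S = Finite 0.
Proof.
  intros h. unfold rho. destruct (excluded_middle_informative _) as [h0|_].
  - now destruct (h 0%nat); apply h0.
  - rewrite (Rbar_is_lub_unique _ m_infty), (Rbar_is_glb_unique _ p_infty).
    + unfold Rbar_div, Rbar_inv, Rbar_mult, Rbar_mult'. destruct (Rle_dec 0 0) as [h0|h0]; [|lra].
      destruct (Rle_lt_or_eq_dec _ _ _); [lra|easy].
    + split; [|intros b _; now destruct b]. now intros x (j & hj & _); apply h in hj.
    + split; [|intros b _; now destruct b]. now intros x (j & hj & _); apply h in hj.
Qed.

Lemma rho_zero (S : nat -> Prop) : (forall n, S n <-> n = 0%nat) -> rho S = Finite 1.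
Proof. intros h. unfold rho. now destruct (excluded_middle_informative _). Qed.

Lemma elasticity_ge (T : Type) (P : T -> Prop) op e a :
  P a -> Rbar_le (rho (lengths P op e a)) (elasticity P op e).
Proof.
  intros h. unfold elasticity, Rbar_lub. destruct (Rbar_ex_lub _) as (l & hl & hl'). simpl.
  apply hl. eauto.
Qed.

Lemma lt_elasticity (T : Type) (P : T -> Prop) op e x :
  Rbar_lt x (elasticity P op e) -> exists a, P a /\ Rbar_lt x (rho (lengths P op e a)).
Proof.
  unfold elasticity, Rbar_lub. destruct (Rbar_ex_lub _) as (l & hl' & hl). simpl. intros h.
  apply NNPP. intros hn. apply Rbar_lt_not_le in h. apply h, hl. intros y (a & ha & ->).
  apply Rbar_not_lt_le. intros hlt. apply hn. eauto.
Qed.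

Lemma Q2R_nat_ratio q :
  (1 < Q2R q)%R -> exists s t, (0 < t < s)%nat /\ Q2R q = (INR s / INR t)%R.
Proof.
  destruct q as [s t]. unfold Q2R. simpl. intros h.
  assert (ht : (0 < IZR (Zpos t))%R) by now apply (IZR_lt 0).
  assert (hs : (IZR (Zpos t) < IZR s)%R).
  { apply Rmult_lt_reg_r with (/ IZR (Zpos t))%R; [now apply Rinv_0_lt_compat|].
    rewrite Rinv_r; lra. }
  apply lt_IZR in hs. exists (Z.to_nat s), (Pos.to_nat t). split; [lia|].
  rewrite !INR_IZR_INZ, Z2Nat.id, positive_nat_Z by lia. reflexivity.
Qed.

Lemma ratio_lt m n s t :
  (0 < n)%nat -> (0 < t)%nat -> (INR s / INR t < INR m / INR n)%R -> (s * n < m * t)%nat.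
Proof.
  intros hn ht h. apply INR_lt. rewrite !mult_INR. apply lt_INR in hn, ht. simpl in hn, ht.
  apply Rmult_lt_compat_r with (r := (INR t * INR n)%R) in h; [|nra].
  replace (INR s / INR t * (INR t * INR n))%R with (INR s * INR n)%R in h by (field; lra).
  replace (INR m / INR n * (INR t * INR n))%R with (INR m * INR t)%R in h by (field; lra).
  exact h.
Qed.

Lemma ratio_le m n m' n' :
  (0 < n)%nat -> (0 < n')%nat -> (INR m' / INR n' <= INR m / INR n)%R -> (m' * n <= m * n')%nat.
Proof.
  intros hn ht h. apply INR_le. rewrite !mult_INR. apply lt_INR in hn, ht. simpl in hn, ht.
  apply Rmult_le_compat_r with (r := (INR n' * INR n)%R) in h; [|nra].
  replace (INR m' / INR n' * (INR n' * INR n))%R with (INR m' * INR n)%R in h by (field; lra).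
  replace (INR m / INR n * (INR n' * INR n))%R with (INR m * INR n')%R in h by (field; lra).
  exact h.
Qed.

(** The laws are relative to [P] because the product of ideals obeys them on ideals, not on
    arbitrary subsets. By [rcm_red] the only unit is [e], so factorizations are plain lists of
    atoms. *)
Record reduced_cmonoid (T : Type) (P : T -> Prop) (op : T -> T -> T) (e : T) : Prop := {
  rcm_one : P e;
  rcm_mul : forall a b, P a -> P b -> P (op a b);
  rcm_assoc : forall a b c, P a -> P b -> P c -> op a (op b c) = op (op a b) c;
  rcm_comm : forall a b, P a -> P b -> op a b = op b a;
  rcm_id : forall a, P a -> op e a = a;
  rcm_red : forall a b, P a -> P b -> op a b = e -> a = e }.

(** * Divisibility and factorizations in a reduced monoid *)

Section Reduced.
Context (T : Type) (P : T -> Prop) (op : T -> T -> T) (e : T).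
Context (hM : reduced_cmonoid T P op e).
Local Infix "**" := op (at level 40, left associativity).
Local Notation prod := (prodl op e).
Local Notation "a ^^ n" := (mpow op e a n) (at level 30).
Local Notation atom := (is_atom P op e).
Local Notation "a ∣ b" := (divides P op a b) (at level 50).
Local Notation L := (lengths P op e).

Lemma one_P : P e.
Proof. apply (rcm_one _ _ _ _ hM). Qed.

Lemma mul_P a b : P a -> P b -> P (a ** b).
Proof. apply (rcm_mul _ _ _ _ hM). Qed.
Local Hint Resolve one_P mul_P : core.

Lemma mul1l a : P a -> e ** a = a.
Proof. apply (rcm_id _ _ _ _ hM). Qed.

Lemma mulC a b : P a -> P b -> a ** b = b ** a.
Proof. apply (rcm_comm _ _ _ _ hM). Qed.

Lemma mulA a b c : P a -> P b -> P c -> a ** (b ** c) = a ** b ** c.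
Proof. apply (rcm_assoc _ _ _ _ hM). Qed.

Lemma mul1r a : P a -> a ** e = a.
Proof. intros h; rewrite mulC; auto; now apply mul1l. Qed.

Lemma mulCA a b c : P a -> P b -> P c -> a ** (b ** c) = b ** (a ** c).
Proof. intros; rewrite !mulA, (mulC a b); auto. Qed.

Lemma mulACA a b c d : P a -> P b -> P c -> P d -> (a ** b) ** (c ** d) = (a ** c) ** (b ** d).
Proof. intros; rewrite <- !mulA, (mulCA b c d); auto. Qed.

Lemma mul_eq1 a b : P a -> P b -> a ** b = e -> a = e /\ b = e.
Proof.
  intros ha hb h; split.
  - exact (rcm_red _ _ _ _ hM a b ha hb h).
  - apply (rcm_red _ _ _ _ hM b a hb ha). now rewrite mulC.
Qed.

Lemma is_unit_iff u : is_unit P op e u <-> u = e.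
Proof.
  split.
  - intros (hu & v & hv & h). now apply (mul_eq1 u v).
  - intros ->. split; [|exists e; split]; auto. apply mul1l; auto.
Qed.

Lemma atom_P u : atom u -> P u.
Proof. now intros (h & _). Qed.

Lemma atom_neq1 u : atom u -> u <> e.
Proof. intros (_ & h & _) ->. apply h, is_unit_iff; auto. Qed.

Lemma atom_split u a b : atom u -> P a -> P b -> u = a ** b -> a = e \/ b = e.
Proof.
  intros (_ & _ & h) ha hb E. destruct (h a b ha hb E) as [h1|h1]; apply is_unit_iff in h1; auto.
Qed.

Lemma Forall_atom_P l : Forall atom l -> Forall P l.
Proof. apply Forall_impl, atom_P. Qed.

Lemma prodl_P l : Forall P l -> P (prod l).
Proof. induction 1; simpl; auto. Qed.
Local Hint Resolve prodl_P Forall_atom_P atom_P : core.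

Lemma prodl_app l1 l2 : Forall P l1 -> Forall P l2 -> prod (l1 ++ l2) = prod l1 ** prod l2.
Proof.
  intros h1 h2; induction h1 as [|x l1 hx h1 IH]; simpl.
  - now rewrite mul1l; auto.
  - rewrite IH, mulA; auto.
Qed.

Lemma prodl_perm l1 l2 : Permutation l1 l2 -> Forall P l1 -> prod l1 = prod l2.
Proof.
  induction 1 as [|x l l' _ IH|x y l|l l' l'' h1 IH1 h2 IH2]; intros h; auto.
  - inversion h; subst; simpl. now rewrite IH.
  - inversion h as [|? ? hy h']; subst. inversion h'; subst. apply mulCA; auto.
  - rewrite IH1 by auto. apply IH2. eapply Permutation_Forall; eauto.
Qed.

Lemma mpow_repeat a n : a ^^ n = prod (repeat a n).
Proof. induction n as [|n IH]; simpl; congruence. Qed.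

Lemma Forall_repeat (A : Type) (Q : A -> Prop) a n : Q a -> Forall Q (repeat a n).
Proof. intros h; induction n; simpl; auto. Qed.

Lemma mpow_P a n : P a -> P (a ^^ n).
Proof. intros; induction n; simpl; auto. Qed.
Local Hint Resolve mpow_P : core.

Lemma mpow_add a m n : P a -> a ^^ (m + n) = a ^^ m ** a ^^ n.
Proof.
  intros h; induction m as [|m IH]; simpl.
  - rewrite mul1l; auto.
  - rewrite IH, mulA; auto.
Qed.

Lemma mpow_op a b n : P a -> P b -> (a ** b) ^^ n = a ^^ n ** b ^^ n.
Proof.
  intros; induction n as [|n IH]; simpl.
  - rewrite mul1l; auto.
  - rewrite IH, mulACA; auto.
Qed.

Lemma mpow_mpow a m n : P a -> (a ^^ m) ^^ n = a ^^ (n * m).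
Proof.
  intros; induction n as [|n IH]; simpl; auto. rewrite IH, mpow_add; auto.
Qed.

Lemma mpow_one n : e ^^ n = e.
Proof. induction n as [|n IH]; simpl; auto. rewrite IH. apply mul1l; auto. Qed.

Lemma divides_intro a b : P a -> P b -> a ∣ a ** b.
Proof. intros; split; [|split]; auto. exists b; auto. Qed.

Lemma divides_refl a : P a -> a ∣ a.
Proof. intros h. rewrite <- (mul1r a h) at 2. apply divides_intro; auto. Qed.

Lemma divides_trans a b c : a ∣ b -> b ∣ c -> a ∣ c.
Proof.
  intros (ha & hb & x & hx & ->) (_ & hc & y & hy & ->).
  rewrite <- mulA; auto. apply divides_intro; auto.
Qed.

Lemma divides_mulr a b c : a ∣ b -> P c -> a ∣ b ** c.
Proof.
  intros h hc. apply divides_trans with b; auto. apply divides_intro; auto. apply h.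
Qed.

Lemma divides_mull a b c : a ∣ b -> P c -> a ∣ c ** b.
Proof. intros h hc. rewrite mulC; auto. now apply divides_mulr. apply h. Qed.

Lemma divides_mul a b c d : a ∣ b -> c ∣ d -> a ** c ∣ b ** d.
Proof.
  intros (ha & hb & x & hx & ->) (hc & hd & y & hy & ->).
  rewrite mulACA; auto. apply divides_intro; auto.
Qed.

Lemma divides_mpow a b n : a ∣ b -> a ^^ n ∣ b ^^ n.
Proof.
  intros h; induction n; simpl.
  - apply divides_refl; auto.
  - now apply divides_mul.
Qed.

Lemma divides_one a : a ∣ e -> a = e.
Proof. intros (ha & _ & c & hc & h). symmetry in h. now apply mul_eq1 in h. Qed.

Lemma divides_prodl a l : Forall P l -> In a l -> a ∣ prod l.
Proof.
  intros hl; induction hl as [|x l hx hl IH]; simpl; [easy|]. intros [->|h].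
  - apply divides_intro; auto.
  - apply divides_mull; auto.
Qed.

Lemma prodl_eq1 l : Forall P l -> prod l = e -> Forall (fun x => x = e) l.
Proof.
  induction 1; simpl; auto. intros h. apply mul_eq1 in h; auto. constructor; tauto.
Qed.

Lemma lengths_iff a n :
  L a n <-> exists us, Forall atom us /\ length us = n /\ a = prod us.
Proof.
  split.
  - intros (u & us & hu & hus & hn & ->). exists us. apply is_unit_iff in hu. subst u.
    rewrite mul1l; auto.
  - intros (us & hus & hn & ->). exists e, us. split; [now apply is_unit_iff|].
    rewrite mul1l; auto.
Qed.

Lemma lengths_P a n : L a n -> P a.
Proof. rewrite lengths_iff. intros (us & h & _ & ->); auto. Qed.

Lemma lengths_0 a : L a 0 -> a = e.
Proof.
  rewrite lengths_iff. intros (us & _ & h & ->). apply length_zero_iff_nil in h. now subst.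
Qed.

Lemma lengths_one n : L e n <-> n = 0%nat.
Proof.
  rewrite lengths_iff. split.
  - intros (us & h & <- & h1). symmetry in h1. apply prodl_eq1 in h1; auto.
    destruct us as [|u us]; auto. inversion h1; inversion h; subst.
    now edestruct (atom_neq1 e).
  - intros ->. exists nil. auto.
Qed.

Lemma lengths_mul a b m n : L a m -> L b n -> L (a ** b) (m + n)%nat.
Proof.
  rewrite !lengths_iff. intros (u & hu & <- & ->) (v & hv & <- & ->).
  exists (u ++ v). rewrite length_app, prodl_app by auto. split; auto.
  now apply Forall_app.
Qed.

Lemma lengths_mpow a m N : L a m -> L (a ^^ N) (N * m)%nat.
Proof.
  intros h; induction N; simpl.
  - now apply lengths_one.
  - now apply lengths_mul.
Qed.

(** * Sets of lengths under multiplication by a cancellative prime *)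

Section PrimeElement.
Context (p : T) (hp : is_prime P op e p).
Context (hcan : forall x y, P x -> P y -> p ** x = p ** y -> x = y).

Lemma prime_P : P p.
Proof. exact (proj1 hp). Qed.
Local Hint Resolve prime_P : core.

Lemma prime_neq1 : p <> e.
Proof. intros h. destruct hp as (_ & hu & _). now apply hu, is_unit_iff. Qed.

(** If [p = a b] and [a = p c], cancelling [p] leaves [c b = e], so [b = e]. *)
Lemma prime_atom : atom p.
Proof.
  assert (key : forall a b, P a -> P b -> p = a ** b -> p ∣ a -> b = e).
  { intros a b ha hb E (_ & _ & c & hc & ->).
    assert (h : e = c ** b).
    { apply hcan; auto. now rewrite mul1r, mulA by auto. }
    symmetry in h. now apply mul_eq1 in h. }
  destruct hp as (_ & hu & hdiv). split; [apply prime_P|split]; auto.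
  intros a b ha hb E. rewrite !is_unit_iff.
  destruct (hdiv a b ha hb) as [h|h].
  - rewrite <- E. now apply divides_refl.
  - right. now apply (key a b).
  - left. apply (key b a); auto. rewrite mulC; auto.
Qed.

Lemma prime_divides_atoms us : Forall atom us -> p ∣ prod us -> In p us.
Proof.
  induction 1 as [|u us hu hus IH]; simpl; intros h.
  - now apply divides_one, prime_neq1 in h.
  - destruct hp as (_ & _ & hdiv). apply hdiv in h; auto. destruct h as [h|h]; auto.
    left. destruct h as (_ & _ & c & hc & E).
    destruct (atom_split u p c hu prime_P hc E) as [h|h].
    + now apply prime_neq1 in h.
    + subst c. now rewrite mul1r in E.
Qed.

(** Every factorization of [p c] contains the atom [p], and cancelling it leaves a factorization of
    [c]. Only [p] is ever cancelled, so this applies to [Ir] with [p] an invertible ideal. *)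
Lemma lengths_prime_mul c n :
  P c -> L (p ** c) n <-> exists m, n = S m /\ L c m.
Proof.
  intros hc. split.
  - rewrite lengths_iff. intros (us & hus & <- & E).
    assert (hin : In p us).
    { apply prime_divides_atoms; auto. rewrite <- E. now apply divides_intro. }
    apply in_split in hin. destruct hin as (l1 & l2 & ->).
    assert (hperm : Permutation (l1 ++ p :: l2) (p :: l1 ++ l2)).
    { symmetry. apply Permutation_middle. }
    rewrite (prodl_perm _ _ hperm) in E by auto.
    apply (Permutation_Forall hperm) in hus. inversion hus; subst.
    simpl in E. apply hcan in E; auto.
    exists (length (l1 ++ l2)). split.
    + now rewrite (Permutation_length hperm).
    + apply lengths_iff. exists (l1 ++ l2). auto.
  - intros (m & -> & h). apply (lengths_mul p c 1 m); auto.
    apply lengths_iff. exists (p :: nil). repeat split; auto using prime_atom.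
    simpl. now rewrite mul1r.
Qed.

Lemma lengths_prime_pow_mul c k n :
  P c -> L (p ^^ k ** c) n <-> exists m, n = (k + m)%nat /\ L c m.
Proof.
  intros hc. revert n. induction k as [|k IH]; intros n; simpl.
  - rewrite mul1l; auto. split; [intros h; exists n; auto|intros (m & -> & h); auto].
  - rewrite <- mulA, lengths_prime_mul by auto. split.
    + intros (m & -> & h). apply IH in h. destruct h as (m' & -> & h). exists m'. auto.
    + intros (m & -> & h). exists (k + m)%nat. split; auto. apply IH. exists m. auto.
Qed.

(* [L (p^k b^N) = k + L (b^N)] has extremal elements [k + N m] and [k + N n]; the choice
   [N = s - t], [k = t m - s n] makes their quotient equal to [s / t]. *)
Lemma rho_attained b m n s t :
  L b m -> L b n -> (0 < n)%nat ->
  (forall N m' n', L (b ^^ N) m' -> L (b ^^ N) n' -> (m' * n <= m * n')%nat) ->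
  (0 < t < s)%nat -> (s * n < m * t)%nat ->
  exists a, P a /\ rho (L a) = Finite (INR s / INR t).
Proof.
  intros hm hn n0 hmax hst hlt.
  set (N := (s - t)%nat). set (k := (m * t - s * n)%nat).
  assert (hb : P b) by (eapply lengths_P; eauto).
  assert (hLm := lengths_mpow b m N hm). assert (hLn := lengths_mpow b n N hn).
  exists (p ^^ k ** b ^^ N). split; auto.
  assert (hL : forall j, L (p ^^ k ** b ^^ N) j <-> exists j', j = (k + j')%nat /\ L (b ^^ N) j').
  { intros j. apply lengths_prime_pow_mul; auto. }
  rewrite (rho_eq _ (k + N * m) (k + N * n)).
  - f_equal.
    assert (E : ((k + N * m) * t = s * (k + N * n))%nat) by (unfold N, k; nia).
    assert (hk : (0 < k + N * n)%nat) by (unfold k; lia).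
    apply (f_equal INR) in E. rewrite !mult_INR in E.
    apply lt_INR in hk. destruct hst as [ht _]. apply lt_INR in ht. simpl in hk, ht.
    field_simplify_eq; [rewrite E; ring|split; lra].
  - intros h. apply hL in h. destruct h as (j & h & _). unfold k in h. lia.
  - apply hL. eauto.
  - apply hL. eauto.
  (* Comparing [j'] with the length [N n] gives [j' <= N m]; comparing [N m] with [j'] gives
     [N n <= j']. *)
  - intros j hj. apply hL in hj. destruct hj as (j' & -> & hj).
    assert (h1 := hmax N j' (N * n)%nat hj hLn). assert (h2 := hmax N (N * m)%nat j' hLm hj).
    split; nia.
Qed.

End PrimeElement.

Lemma rho_one : rho (L e) = Finite 1.
Proof. apply rho_zero, lengths_one. Qed.

Lemma lengths_of_rho_gt1 a q :
  Rbar_lt (Finite 1) (Finite q) -> Rbar_lt (Finite q) (rho (L a)) -> ~ L a 0%nat /\ exists n, L a n.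
Proof.
  intros hq h. split.
  - intros h0. apply lengths_0 in h0. subst a. rewrite rho_one in h. simpl in *. lra.
  - apply NNPP. intros hn. rewrite rho_empty in h; [simpl in *; lra|]. eauto.
Qed.

(** Finiteness of [L b] makes its supremum and infimum a maximum [m] and a minimum [n]; that no
    power of [b] has a larger [rho] is then restated without division. *)
Lemma accepted_ratio b B q :
  P b -> (forall n, L b n -> (n <= B)%nat) ->
  Rbar_lt (Finite 1) (Finite q) -> Rbar_lt (Finite q) (rho (L b)) ->
  (forall N, Rbar_le (rho (L (b ^^ N))) (rho (L b))) ->
  exists m n, L b m /\ L b n /\ (0 < n)%nat /\ (q < INR m / INR n)%R /\
    forall N m' n', L (b ^^ N) m' -> L (b ^^ N) n' -> (m' * n <= m * n')%nat.
Proof.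
  intros hb hB h1 hq hacc.
  destruct (lengths_of_rho_gt1 b q h1 hq) as (h0 & k & hk).
  destruct (nat_min (L b) k hk) as (n & hn & hmin).
  destruct (nat_max (L b) k B hk hB) as (m & hm & hmax).
  assert (n0 : (0 < n)%nat) by (destruct n; [easy|lia]).
  assert (E : rho (L b) = Finite (INR m / INR n)) by (apply rho_eq; auto).
  exists m, n. rewrite E in hq. do 4 (split; auto). intros N m' n' hm' hn'.
  (* A length 0 forces [b^N = e], hence also [m' = 0]. *)
  destruct n' as [|n'].
  - apply lengths_0 in hn'. rewrite hn' in hm'. apply lengths_one in hm'. lia.
  - apply ratio_le; auto; [lia|]. specialize (hacc N). rewrite E in hacc.
    change (Rbar_le (Finite (INR m' / INR (S n'))) (Finite (INR m / INR n))).
    refine (Rbar_le_trans _ _ _ _ hacc). apply rho_ge; auto.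
    intros h. apply lengths_0 in h. rewrite h in hn'. now apply lengths_one in hn'.
Qed.

(** * Divisor-closed submonoids generated by one element *)

Section DivisorClosed.
Context (a0 : T) (ha0 : P a0).
Local Notation D := (dc_sub P op e a0).

Lemma dc_sub_P b : D b -> P b.
Proof. now intros (h & _). Qed.
Local Hint Resolve dc_sub_P : core.

Lemma dc_sub_one : D e.
Proof. split; auto. exists 0%nat. now apply divides_refl. Qed.

Lemma dc_sub_mul b c : D b -> D c -> D (b ** c).
Proof.
  intros (hb & i & hi) (hc & j & hj). split; auto. exists (i + j)%nat.
  rewrite mpow_add by auto. now apply divides_mul.
Qed.

Lemma dc_sub_divides b c : b ∣ c -> D c -> D b.
Proof.
  intros h (_ & n & hn). split; [apply h|]. exists n. now apply divides_trans with c.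
Qed.

Lemma dc_sub_self : D a0.
Proof. split; auto. exists 1%nat. simpl. rewrite mul1r by auto. now apply divides_refl. Qed.

Lemma dc_sub_mpow b N : D b -> D (b ^^ N).
Proof. intros h; induction N; simpl; auto using dc_sub_one, dc_sub_mul. Qed.

(** Both factors of any splitting of [u] divide [u], hence lie in the submonoid: atoms, and
    therefore sets of lengths, are the same there as in the whole monoid. *)
Lemma dc_sub_atom u : D u -> is_atom D op e u <-> atom u.
Proof.
  assert (hu1 : forall v, is_unit D op e v <-> v = e).
  { intros v. split.
    - intros (hv & w & hw & E). now apply mul_eq1 in E; auto.
    - intros ->. split; [|exists e; split]; auto using dc_sub_one, mul1l. }
  intros hu. unfold is_atom. rewrite hu1, is_unit_iff. split.
  - intros (_ & h1 & h). do 2 (split; auto). intros b c hb hc E.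
    rewrite !is_unit_iff. rewrite <- !hu1. apply h; auto; apply dc_sub_divides with u; auto; rewrite E.
    + now apply divides_intro.
    + apply divides_mull; auto. now apply divides_refl.
  - intros (_ & h1 & h). do 2 (split; auto). intros b c hb hc E.
    rewrite !hu1. rewrite <- !is_unit_iff. auto.
Qed.

Lemma dc_sub_lengths b n : D b -> lengths D op e b n <-> L b n.
Proof.
  intros hb. rewrite lengths_iff. split.
  - intros (eps & us & (heps & v & hv & hu) & hus & <- & ->).
    apply mul_eq1 in hu; auto. destruct hu as [-> _].
    assert (h : Forall atom us).
    { eapply Forall_impl; [|exact hus]. intros u h. apply dc_sub_atom; auto. apply h. }
    exists us. rewrite mul1l; auto.
  - intros (us & hus & <- & ->). exists e, us. split; [|split; [|split]]; auto.
    + split; [|exists e; split]; auto using dc_sub_one, mul1l.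
    + rewrite Forall_forall in *. intros u hu.
      assert (D u).
      { apply dc_sub_divides with (prod us); auto. apply divides_prodl; auto.
        apply Forall_atom_P, Forall_forall; auto. }
      apply dc_sub_atom; auto.
    + now rewrite mul1l; auto.
Qed.

Lemma dc_sub_rho b : D b -> rho (lengths D op e b) = rho (L b).
Proof.
  intros h. f_equal. apply functional_extensionality. intros n.
  now apply propositional_extensionality, dc_sub_lengths.
Qed.

End DivisorClosed.

(** Both alternatives yield [b] with [rho (L b)] above [q] and maximal among its powers. In the
    local one, [q < rho (L a)] for some [a], and [b] realizes the elasticity of the submonoid
    generated by [a], which contains all powers of [b]. *)
Theorem fully_elastic_of_accepted p :
  is_prime P op e p -> (forall x y, P x -> P y -> p ** x = p ** y -> x = y) ->
  (forall a, P a -> exists B, forall n, L a n -> (n <= B)%nat) ->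
  accepted_elasticity P op e \/
    (forall a, P a -> accepted_elasticity (dc_sub P op e a) op e) ->
  fully_elastic P op e.
Proof.
  intros hp hcan hbf hacc q h1 hq.
  assert (hb : exists b, P b /\ Rbar_lt (Q2R q) (rho (L b)) /\
            forall N, Rbar_le (rho (L (b ^^ N))) (rho (L b))).
  { destruct hacc as [(b & hb & E)|hacc].
    - exists b. rewrite E. do 2 (split; auto). intros N. apply elasticity_ge. auto.
    - destruct (lt_elasticity _ _ _ _ _ hq) as (a & ha & hqa).
      destruct (hacc a ha) as (b & hb & E). rewrite dc_sub_rho in E by auto.
      exists b. split; [now apply hb|]. rewrite E. split.
      + eapply Rbar_lt_le_trans; [exact hqa|]. rewrite <- (dc_sub_rho a) by now apply dc_sub_self.
        now apply elasticity_ge, dc_sub_self.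
      + intros N. rewrite <- (dc_sub_rho a) by now apply dc_sub_mpow.
        now apply elasticity_ge, dc_sub_mpow. }
  destruct hb as (b & hb & hqb & hN). destruct (hbf b hb) as (B & hB).
  destruct (accepted_ratio b B (Q2R q)) as (m & n & hm & hn & n0 & hlt & hmax); auto.
  destruct (Q2R_nat_ratio q h1) as (s & t & hst & E). rewrite E in *.
  apply (rho_attained p hp hcan b m n s t); auto. apply ratio_lt; auto. lia.
Qed.

End Reduced.

(** * Locally finitely generated monoids *)

Lemma dependent_choice (A : Type) (Q : A -> Prop) (R : A -> A -> Prop) a0 :
  Q a0 -> (forall a, Q a -> exists b, Q b /\ R a b) ->
  exists f : nat -> A, f 0%nat = a0 /\ (forall n, Q (f n)) /\ forall n, R (f n) (f (S n)).
Proof.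
  intros h0 h.
  destruct (choice (fun (x y : {a | Q a}) => R (proj1_sig x) (proj1_sig y))) as (g & hg).
  { intros (a & ha). destruct (h a ha) as (b & hb & hab). now exists (exist _ b hb). }
  set (f := fix f n := match n with O => exist Q a0 h0 | S n => g (f n) end).
  exists (fun n => proj1_sig (f n)). split; [reflexivity|]. split.
  - intros n. apply proj2_sig.
  - intros n. apply hg.
Qed.

Lemma strictly_increasing (g : nat -> nat) :
  (forall n, (g n < g (S n))%nat) -> forall i j, (i < j)%nat -> (g i < g j)%nat.
Proof.
  intros h i j hij. induction hij as [|j hij IH]; auto. specialize (h j). lia.
Qed.

(** Call an index good if its value is minimal among all later ones. Every tail attains its minimum,
    so good indices are unbounded, and [u] is nondecreasing along them. *)
Lemma nondecreasing_subsequence (u : nat -> nat) :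
  exists g : nat -> nat, (forall i j, (i < j)%nat -> (g i < g j)%nat) /\
    forall i j, (i < j)%nat -> (u (g i) <= u (g j))%nat.
Proof.
  set (good := fun k => forall j, (k <= j)%nat -> (u k <= u j)%nat).
  assert (h : forall n, exists k, (n <= k)%nat /\ good k).
  { intros n. destruct (nat_min (fun v => exists k, (n <= k)%nat /\ u k = v) (u n))
      as (v & (k & hk & <-) & hv).
    - now exists n.
    - exists k. split; auto. intros j hj. apply hv. exists j. split; auto. lia. }
  destruct (h 0%nat) as (k0 & _ & hk0).
  destruct (dependent_choice _ good lt k0 hk0) as (g & _ & hg & hlt).
  { intros k _. destruct (h (S k)) as (k' & hk & hg). exists k'. split; auto. }
  exists g. assert (hinc := strictly_increasing g hlt). split; auto.
  intros i j hij. apply hg. specialize (hinc i j hij). lia.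
Qed.

(** Each coordinate is made monotone along a further subsequence, which preserves monotonicity of
    the coordinates already treated. *)
Lemma dickson (A : Type) (phis : list (A -> nat)) (s : nat -> A) :
  exists g : nat -> nat, (forall i j, (i < j)%nat -> (g i < g j)%nat) /\
    forall phi i j, In phi phis -> (i < j)%nat -> (phi (s (g i)) <= phi (s (g j)))%nat.
Proof.
  induction phis as [|phi phis (g & hg & hphi)].
  - exists (fun n => n). now split.
  - destruct (nondecreasing_subsequence (fun n => phi (s (g n)))) as (g' & hg' & hmono).
    exists (fun n => g (g' n)). split; auto.
    intros psi i j [<-|hin] hij; auto.
Qed.

Definition classical_eq_dec (A : Type) (x y : A) : {x = y} + {x <> y} :=
  excluded_middle_informative (x = y).
Local Notation count l x := (count_occ (classical_eq_dec _) l x).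

Lemma sublist_complement (A : Type) (l l' : list A) :
  (forall x, (count l x <= count l' x)%nat) -> exists m, Permutation l' (l ++ m).
Proof.
  revert l'. induction l as [|x l IH]; intros l' h.
  - now exists l'.
  - assert (hx := h x). rewrite count_occ_cons_eq in hx by auto.
    assert (hin : In x l') by (apply (count_occ_In (classical_eq_dec A)); lia).
    apply in_split in hin. destruct hin as (l1 & l2 & ->).
    assert (hp : Permutation (l1 ++ x :: l2) (x :: l1 ++ l2)) by (symmetry; apply Permutation_middle).
    destruct (IH (l1 ++ l2)) as (m & hm).
    + intros y. specialize (h y). rewrite (Permutation_count_occ (classical_eq_dec A)) in hp.
      rewrite hp in h. simpl in h. destruct (classical_eq_dec A x y); lia.
    + exists m. rewrite hp, hm. reflexivity.
Qed.

Lemma partition_classical (A : Type) (Q : A -> Prop) l :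
  exists l1 l2, Permutation l (l1 ++ l2) /\ Forall Q l1 /\ Forall (fun x => ~ Q x) l2.
Proof.
  induction l as [|x l (l1 & l2 & hp & h1 & h2)].
  - now exists nil, nil.
  - destruct (classic (Q x)) as [h|h].
    + exists (x :: l1), l2. split; auto. simpl. now rewrite hp.
    + exists l1, (x :: l2). split; auto. rewrite hp. apply Permutation_middle.
Qed.

(** An entry may be related to several elements of [E]. The relation will be equality with a
    generator, and later inclusion in a maximal [r]-ideal. *)
Lemma pigeonhole (A B : Type) (R : A -> B -> Prop) (E : list B) k l :
  Forall (fun x => exists b, In b E /\ R x b) l -> (length E * k < length l)%nat ->
  exists b l1 l2, In b E /\ Permutation l (l1 ++ l2) /\ length l1 = k /\
    Forall (fun x => R x b) l1.
Proof.
  revert l. induction E as [|b E IH]; intros l h hlen.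
  - destruct h as [|x l (b & hb & _)]; simpl in *; [lia|easy].
  - destruct (partition_classical _ (fun x => R x b) l) as (l1 & l2 & hp & h1 & h2).
    assert (hl := Permutation_length hp). rewrite length_app in hl. simpl in hlen.
    destruct (le_lt_dec k (length l1)) as [hk|hk].
    + exists b, (firstn k l1), (skipn k l1 ++ l2). split; [now left|].
      rewrite app_assoc, firstn_skipn. split; auto. split.
      * now apply firstn_length_le.
      * rewrite <- (firstn_skipn k l1) in h1. now apply Forall_app in h1.
    + destruct (IH l2) as (b' & m1 & m2 & hb & hp' & hm & hR).
      * apply (Permutation_Forall hp), Forall_app in h. destruct h as [_ h].
        rewrite Forall_forall in *. intros x hx. destruct (h x hx) as (b' & [<-|hb] & hR).
        -- now destruct (h2 x hx).
        -- eauto.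
      * lia.
      * exists b', m1, (m2 ++ l1). split; [now right|]. split; auto.
        rewrite hp, Permutation_app_comm, hp', app_assoc. reflexivity.
Qed.

(** The bound on ratios itself makes [S] finite: against a fixed length [n1], every [j] in [S]
    satisfies [j <= j n <= m n1]. *)
Lemma rho_le (S : nat -> Prop) m n k :
  ~ S 0%nat -> S k -> (0 < n)%nat ->
  (forall m' n', S m' -> S n' -> (m' * n <= m * n')%nat) ->
  Rbar_le (rho S) (Finite (INR m / INR n)).
Proof.
  intros h0 hk n0 h. destruct (nat_min S k hk) as (n1 & hn1 & hmin).
  destruct (nat_max S k (m * n1) hk) as (m1 & hm1 & hmax).
  { intros j hj. specialize (h j n1 hj hn1). nia. }
  rewrite (rho_eq S m1 n1) by auto. simpl.
  assert (n1 <> 0)%nat by (intros ->; auto).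
  specialize (h m1 n1 hm1 hn1). apply le_INR in h. rewrite !mult_INR in h.
  assert (hn : (0 < INR n)%R) by now apply lt_0_INR.
  assert (hn' : (0 < INR n1)%R) by (apply lt_0_INR; lia).
  apply Rmult_le_reg_r with (INR n1 * INR n)%R; [nra|]. field_simplify; lra.
Qed.

Section Cancellative.
Context (T : Type) (P : T -> Prop) (op : T -> T -> T) (e : T).
Context (hM : reduced_cmonoid T P op e).
Local Infix "**" := op (at level 40, left associativity).
Context (hcan : forall x y z, P x -> P y -> P z -> x ** y = x ** z -> y = z).
Local Notation prod := (prodl op e).
Local Notation "a ^^ n" := (mpow op e a n) (at level 30).
Local Notation atom := (is_atom P op e).
Local Notation "a ∣ b" := (divides P op a b) (at level 50).
Local Notation L := (lengths P op e).

Let one_P : P e := one_P _ _ _ _ hM.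
Let mul_P a b : P a -> P b -> P (a ** b) := mul_P _ _ _ _ hM a b.
Let prodl_P l : Forall P l -> P (prod l) := prodl_P _ _ _ _ hM l.
Let mpow_P a n : P a -> P (a ^^ n) := mpow_P _ _ _ _ hM a n.
Let atom_P u : atom u -> P u := atom_P _ _ _ _ u.
Let Forall_atom_P l : Forall atom l -> Forall P l := Forall_atom_P _ _ _ _ l.
Local Hint Resolve one_P mul_P prodl_P mpow_P atom_P Forall_atom_P : core.

(** * Relations between finitely many atoms and their length ratios *)

Section Relations.
Context (gens : list T) (hgens : Forall atom gens).

Local Notation word l := (Forall (fun u => In u gens) l).
(** Two factorizations of one element over the atoms [gens]. A nonempty second word keeps the ratio
    of first to second length meaningful. *)
Definition relation (d : list T * list T) : Prop :=
  word (fst d) /\ word (snd d) /\ prod (fst d) = prod (snd d) /\ snd d <> nil.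
Local Notation ratio_lt d d' :=
  (length (fst d) * length (snd d') < length (fst d') * length (snd d))%nat.

Let word_atoms l : word l -> Forall atom l.
Proof. rewrite !Forall_forall in *. auto. Qed.
Let word_P l : word l -> Forall P l.
Proof. intros h. now apply Forall_atom_P, word_atoms. Qed.
Local Hint Resolve word_P : core.

(* If [d <= d'] componentwise, then [d' - d] is again a relation, and the ratio of [d'] is the
   mediant of those of [d] and [d' - d]. *)
Lemma relation_complement d d' :
  relation d -> relation d' -> ratio_lt d d' ->
  (forall u, In u gens -> (count (fst d) u <= count (fst d') u)%nat) ->
  (forall u, In u gens -> (count (snd d) u <= count (snd d') u)%nat) ->
  exists d'', relation d'' /\ ratio_lt d' d'' /\
    (length (fst d'') + length (snd d'') < length (fst d') + length (snd d'))%nat.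
Proof.
  destruct d as [l1 l2], d' as [k1 k2]. unfold relation. simpl.
  intros (h1 & h2 & hE & hne) (h1' & h2' & hE' & _) hlt hc1 hc2.
  assert (compl : forall l k, word l -> word k ->
    (forall u, In u gens -> (count l u <= count k u)%nat) -> exists m, word m /\ Permutation k (l ++ m)).
  { intros l k hl hk hc. destruct (sublist_complement _ l k) as (m & hm).
    - intros u. destruct (classic (In u l)) as [h|h].
      + apply hc. rewrite Forall_forall in hl. auto.
      + apply (count_occ_not_In (classical_eq_dec T)) in h. lia.
    - exists m. split; auto. apply (Permutation_Forall hm), Forall_app in hk. easy. }
  destruct (compl l1 k1 h1 h1' hc1) as (m1 & hm1 & hp1).
  destruct (compl l2 k2 h2 h2' hc2) as (m2 & hm2 & hp2).
  assert (e1 := Permutation_length hp1). assert (e2 := Permutation_length hp2).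
  rewrite length_app in e1, e2.
  assert (hm : prod m1 = prod m2).
  { apply (hcan (prod l1)); auto. rewrite hE at 2.
    rewrite <- !(prodl_app _ _ _ _ hM) by auto.
    rewrite <- (prodl_perm _ _ _ _ hM _ _ hp1), <- (prodl_perm _ _ _ _ hM _ _ hp2) by auto.
    exact hE'. }
  assert (l2pos : length l2 <> 0%nat) by (intros h; now apply length_zero_iff_nil in h).
  exists (m1, m2). simpl. rewrite e1, e2 in *. split; [|split].
  (* If [m2] were empty, then [prod m1 = e] would make [m1] empty too, and [d], [d'] would have
     equal ratios. *)
  - do 3 (split; auto). intros ->. simpl in *.
    apply (prodl_eq1 _ _ _ _ hM) in hm; auto. apply word_atoms in hm1.
    destruct m1 as [|u m1]; [simpl in *; lia|].
    inversion hm; inversion hm1; subst. now apply (atom_neq1 _ _ _ _ hM e).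
  - nia.
  - lia.
Qed.

(** Otherwise there is an infinite chain of relations in which each successor has a larger ratio
    and, among those of larger ratio, the least total length. By Dickson's lemma some term dominates
    an earlier one componentwise; their difference has a still larger ratio and smaller total
    length, against the choice of the dominating term. *)
Lemma max_ratio_relation d0 :
  relation d0 -> exists d, relation d /\ forall d', relation d' -> ~ ratio_lt d d'.
Proof.
  intros h0. apply NNPP. intros hno.
  set (R := fun d d' : list T * list T => relation d' /\ ratio_lt d d' /\
    forall d'', relation d'' -> ratio_lt d d'' ->
      (length (fst d') + length (snd d') <= length (fst d'') + length (snd d''))%nat).
  destruct (dependent_choice _ relation R d0 h0) as (f & _ & hf & hR).
  { intros d hd. assert (hex : exists d', relation d' /\ ratio_lt d d').
    { apply NNPP. intros h. apply hno. exists d. split; auto. intros d' hd' hlt. eauto. }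
    destruct hex as (d1 & hd1 & hlt1).
    destruct (nat_min (fun v => exists d', relation d' /\ ratio_lt d d' /\
        v = (length (fst d') + length (snd d'))%nat) (length (fst d1) + length (snd d1)))
      as (v & (d' & hd' & hlt & ->) & hmin); [eauto|].
    exists d'. split; auto. split; auto. split; auto. intros d'' hd'' hlt''. apply hmin. eauto. }
  assert (snd_pos : forall n, (0 < length (snd (f n)))%nat).
  { intros n. destruct (hf n) as (_ & _ & _ & h). destruct (snd (f n)); simpl; [easy|lia]. }
  assert (chain : forall i j, (i <= j)%nat -> ratio_lt (f i) (f (S j))).
  { intros i j hij. induction hij as [|j hij IH]; [apply hR|].
    assert (h := proj1 (proj2 (hR (S j)))).
    assert (p1 := snd_pos i). assert (p2 := snd_pos (S j)). assert (p3 := snd_pos (S (S j))).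
    clear - IH h p1 p2 p3.
    set (b1 := length (snd (f i))) in *. set (b2 := length (snd (f (S j)))) in *.
    set (b3 := length (snd (f (S (S j))))) in *. set (a1 := length (fst (f i))) in *.
    set (a2 := length (fst (f (S j)))) in *. set (a3 := length (fst (f (S (S j))))) in *.
    clearbody a1 a2 a3 b1 b2 b3.
    apply (Nat.mul_lt_mono_pos_r b2); auto.
    assert (a1 * b2 * b3 < a2 * b1 * b3)%nat by (now apply Nat.mul_lt_mono_pos_r).
    assert (a2 * b3 * b1 < a3 * b2 * b1)%nat by (now apply Nat.mul_lt_mono_pos_r).
    lia. }
  destruct (dickson _ (map (fun u (d : list T * list T) => count (fst d) u) gens ++
                       map (fun u (d : list T * list T) => count (snd d) u) gens) f) as (g & hg & hmono).
  assert (h01 : (g 0 < g 1)%nat) by (apply hg; lia).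
  (* The dominating term must be a successor [f (S j)], since its minimality was imposed when it was
     chosen after [f j]. *)
  destruct (g 1%nat) as [|j] eqn:Ej; [lia|].
  destruct (relation_complement (f (g 0%nat)) (f (S j))) as (d & hd & hlt & hsize); auto.
  - apply chain. lia.
  - intros u hu. rewrite <- Ej. apply (hmono (fun d : list T * list T => count (fst d) u)); [|lia].
    apply in_or_app. left. apply in_map_iff. now exists u.
  - intros u hu. rewrite <- Ej. apply (hmono (fun d : list T * list T => count (snd d) u)); [|lia].
    apply in_or_app. right. apply in_map_iff. now exists u.
  - destruct (hR j) as (_ & hj & hmin). apply Nat.lt_nge in hsize. apply hsize, hmin; auto.
    assert (p1 := snd_pos j). assert (p2 := snd_pos (S j)).
    set (b1 := length (snd (f j))) in *. set (b2 := length (snd (f (S j)))) in *.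
    set (a1 := length (fst (f j))) in *.
    set (a2 := length (fst (f (S j)))) in *. set (a3 := length (fst d)) in *.
    set (b3 := length (snd d)) in *.
    assert (p3 : (0 < b3)%nat).
    { destruct hd as (_ & _ & _ & h). unfold b3. destruct (snd d); simpl; [easy|lia]. }
    clearbody a1 a2 a3 b1 b2 b3. clear - hlt hj p1 p2 p3.
    apply (Nat.mul_lt_mono_pos_r b2); auto.
    assert (a1 * b2 * b3 < a2 * b1 * b3)%nat by (now apply Nat.mul_lt_mono_pos_r).
    assert (a2 * b3 * b1 < a3 * b2 * b1)%nat by (now apply Nat.mul_lt_mono_pos_r).
    lia.
Qed.

End Relations.

Lemma atom_in_generators gens u :
  (forall g, In g gens -> P g) -> atom u ->
  (exists us, Forall (fun g => In g gens) us /\ u = prod us) -> In u gens.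
Proof.
  intros hg hu (us & hus & E). subst u.
  assert (hP : Forall P us) by (eapply Forall_impl; [|exact hus]; auto).
  induction hus as [|g us hin hus IH]; simpl in *.
  - now apply (atom_neq1 _ _ _ _ hM) in hu.
  - inversion hP; subst.
    destruct (atom_split _ _ _ _ hM _ g (prod us) hu) as [h|h]; auto.
    + subst g. rewrite (mul1l _ _ _ _ hM) in * by auto. auto.
    + rewrite h, (mul1r _ _ _ _ hM) by auto. auto.
Qed.

(** Atoms dividing a power of [a] occur among the finitely many generators, so any two lengths of an
    element of this submonoid come from a relation. A relation [(l1, l2)] of maximal ratio supplies
    the element [prod l1], whose lengths [length l1] and [length l2] bound all ratios in the
    submonoid, in particular [rho (L a) > q]. *)
Theorem fully_elastic_of_locally_fg p :
  is_prime P op e p -> locally_fg P op e -> fully_elastic P op e.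
Proof.
  intros hp hfg q h1 hq. assert (hpP : P p) by apply hp.
  destruct (lt_elasticity _ _ _ _ _ hq) as (a & ha & hqa).
  destruct (lengths_of_rho_gt1 _ _ _ _ hM a (Q2R q) h1 hqa) as (h0 & n0 & hn0).
  destruct (hfg a ha) as (gens & hgens & hgen).
  destruct (partition_classical _ atom gens) as (A & A' & hA & hatoms & hnatoms).
  assert (hword : forall b us, dc_sub P op e a b -> Forall atom us -> b = prod us ->
            Forall (fun u => In u A) us).
  { intros b us hb hus ->. rewrite Forall_forall in *. intros u hu.
    assert (hin : In u gens).
    { apply atom_in_generators; auto.
      - intros g hg. now apply hgens.
      - destruct (hgen u) as (eps & vs & heps & hvs & ->).
        + apply (dc_sub_divides _ _ _ _ hM) with (prod us); auto.
          apply (divides_prodl _ _ _ _ hM); auto. apply Forall_atom_P, Forall_forall; auto.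
        + exists vs. split; auto. apply (is_unit_iff _ _ _ _ hM) in heps. subst.
          apply (mul1l _ _ _ _ hM), prodl_P. eapply Forall_impl; [|exact hvs].
          intros g hg. now apply hgens. }
    apply (Permutation_in _ hA), in_app_or in hin. destruct hin as [|hin]; auto.
    now destruct (hnatoms u hin); apply hus. }
  assert (hrel : forall b m n, dc_sub P op e a b -> ~ L b 0%nat -> L b m -> L b n ->
            exists d, relation A d /\ b = prod (fst d) /\ length (fst d) = m /\ length (snd d) = n).
  { intros b m n hb hb0 hm hn. apply (lengths_iff _ _ _ _ hM) in hm, hn.
    destruct hm as (us & hus & <- & E), hn as (vs & hvs & <- & E').
    exists (us, vs). split; [|auto]. split; [|split; [|split]]; simpl; eauto.
    - congruence.
    - intros ->. apply hb0. apply (lengths_iff _ _ _ _ hM). exists nil. auto. }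
  assert (haa := dc_sub_self _ _ _ _ hM a ha).
  destruct (hrel a n0 n0) as (d0 & hd0 & _); auto.
  destruct (max_ratio_relation A hatoms d0 hd0) as ((l1 & l2) & hl & hmax).
  assert (hle : forall b, dc_sub P op e a b -> forall m n, L b m -> L b n ->
            (m * length l2 <= length l1 * n)%nat).
  { intros b hb m n hm hn. destruct (classic (L b 0%nat)) as [hb0|hb0].
    - apply (lengths_0 _ _ _ _ hM) in hb0. subst b. apply (lengths_one _ _ _ _ hM) in hm.
      lia.
    - destruct (hrel b m n) as (d & hd & _ & <- & <-); auto.
      specialize (hmax d hd). simpl in hmax. lia. }
  destruct hl as (hl1 & hl2 & E & hne). simpl in *.
  assert (l2pos : (0 < length l2)%nat) by (destruct l2; simpl; [easy|lia]).
  assert (hword_atoms : forall l, Forall (fun u => In u A) l -> Forall atom l).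
  { intros l. rewrite !Forall_forall in *. auto. }
  destruct (Q2R_nat_ratio q h1) as (s & t & hst & Eq). rewrite Eq in *.
  assert (hbD : dc_sub P op e a (prod l1)).
  { clear - hl1 hM hgens hA ha mpow_P. induction hl1 as [|u l hu hl IH]; simpl.
    - now apply (dc_sub_one _ _ _ _ hM).
    - apply (dc_sub_mul _ _ _ _ hM); auto. rewrite Forall_forall in hgens. apply hgens.
      apply (Permutation_in _ (Permutation_sym hA)). apply in_or_app; auto. }
  apply (rho_attained _ _ _ _ hM p hp) with (prod l1) (length l1) (length l2); auto.
  - intros x y hx hy. now apply hcan.
  - apply (lengths_iff _ _ _ _ hM). eauto.
  - apply (lengths_iff _ _ _ _ hM). eauto.
  - intros N m n hm hn. apply (hle (prod l1 ^^ N)); auto. now apply (dc_sub_mpow _ _ _ _ hM).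
  - apply ratio_lt; auto; [lia|].
    refine (Rbar_lt_le_trans (Finite _) _ (Finite _) hqa _).
    apply rho_le with n0; auto. intros m n. now apply hle.
Qed.

End Cancellative.

(** * Bounded factorizations in v-noetherian monoids *)

Section Noetherian.
Context (T : Type) (P : T -> Prop) (op : T -> T -> T) (e : T).
Context (hM : reduced_cmonoid T P op e).
Local Infix "**" := op (at level 40, left associativity).
Context (hcan : forall x y z, P x -> P y -> P z -> x ** y = x ** z -> y = z).
Local Notation prod := (prodl op e).
Local Notation "a ^^ n" := (mpow op e a n) (at level 30).
Local Notation atom := (is_atom P op e).
Local Notation "a ∣ b" := (divides P op a b) (at level 50).
Local Notation L := (lengths P op e).

(* The [v]-closure of [X]: in the quotient group, [x] lies in [X_v] iff every fraction [t / a]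
   with [(t / a) X] integral also makes [(t / a) x] integral. *)
Definition vclosure (X : T -> Prop) : T -> Prop :=
  fun x => P x /\ forall a t, P a -> P t -> (forall y, X y -> a ∣ t ** y) -> a ∣ t ** x.

(** This is [v]-noetherianity in finitary form; the generators [E] can be chosen inside [X]
    itself. *)
Context (hfg : forall X, subset X P ->
  exists E, Forall X E /\ forall x, X x -> vclosure (fun y => In y E) x).

Let one_P : P e := one_P _ _ _ _ hM.
Let mul_P a b : P a -> P b -> P (a ** b) := mul_P _ _ _ _ hM a b.
Let prodl_P l : Forall P l -> P (prod l) := prodl_P _ _ _ _ hM l.
Let mpow_P a n : P a -> P (a ^^ n) := mpow_P _ _ _ _ hM a n.
Let atom_P u : atom u -> P u := atom_P _ _ _ _ u.
Let Forall_atom_P l : Forall atom l -> Forall P l := Forall_atom_P _ _ _ _ l.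
Local Hint Resolve one_P mul_P prodl_P mpow_P atom_P Forall_atom_P : core.

Definition vclosed (X : T -> Prop) : Prop := subset X P /\ subset (vclosure X) X.

Lemma vclosure_mono X Y : subset X Y -> subset (vclosure X) (vclosure Y).
Proof. intros h x (hx & h'). split; auto. Qed.

(** The union of an ascending chain is generated by finitely many of its elements; these lie in one
    member, which, being closed, contains the whole union. *)
Lemma vclosed_maximal (F : (T -> Prop) -> Prop) X0 :
  F X0 -> (forall X, F X -> vclosed X) ->
  exists X, F X /\ forall Y, F Y -> subset X Y -> subset Y X.
Proof.
  intros h0 hF. apply NNPP. intros hno.
  destruct (dependent_choice _ F (fun X Y => subset X Y /\ ~ subset Y X) X0 h0)
    as (f & _ & hf & hR).
  { intros X hX. apply NNPP. intros h. apply hno. exists X. split; auto.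
    intros Y hY hXY. apply NNPP. intros hYX. apply h. exists Y. auto. }
  assert (hinc : forall i j, (i <= j)%nat -> subset (f i) (f j)).
  { intros i j hij. induction hij as [|j hij IH]; intros x hx; auto. now apply hR, IH. }
  destruct (hfg (fun x => exists n, f n x)) as (E & hE & hgen).
  { intros x (n & hn). now apply (hF (f n)). }
  assert (hN : exists N, Forall (f N) E).
  { clear - hE hinc. induction hE as [|x E (n & hn) hE (N & IH)].
    - exists 0%nat. constructor.
    - exists (n + N)%nat. constructor.
      + apply (hinc n); auto. lia.
      + eapply Forall_impl; [|exact IH]. apply hinc. lia. }
  destruct hN as (N & hN). destruct (hR N) as (_ & h). apply h. intros x hx.
  apply (hF (f N)); auto. apply vclosure_mono with (fun y => In y E); eauto.
  intros y hy. rewrite Forall_forall in hN. auto.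
Qed.

(** The colon of the radical of the principal ideal of [a] by [w]; for [w = e] it is the radical
    itself. *)
Definition radical_colon (a w x : T) : Prop := P x /\ exists j, a ∣ (w ** x) ^^ j.

(** One exponent [k] works for all generators in [E]. Among [length E * k + 1] of them, some [x]
    occurs [k] times, and [a] divides [(w x)^k]. *)
Lemma radical_colon_bounded a w X :
  P a -> P w -> subset X (radical_colon a w) ->
  exists K, forall l, Forall (vclosure X) l -> length l = K -> a ∣ w ^^ K ** prod l.
Proof.
  intros ha hw hX. destruct (hfg X) as (E & hE & hgen); [intros x hx; now apply hX|].
  assert (hEP : forall x, In x E -> P x).
  { rewrite Forall_forall in hE. intros x hx. now apply hX, hE. }
  assert (hk : exists k, forall x, In x E -> a ∣ (w ** x) ^^ k).
  { clear hgen. induction hE as [|x E hx hE IH]; [now exists 0%nat|].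
    destruct IH as (k & IH).
    - intros y hy. apply hEP. now right.
    - destruct (hX x hx) as (hxP & j & hj). exists (j + k)%nat. intros y [<-|hy].
      + rewrite (mpow_add _ _ _ _ hM) by auto. apply (divides_mulr _ _ _ _ hM); auto.
      + assert (P y) by (apply hEP; now right).
        rewrite (mpow_add _ _ _ _ hM) by auto. apply (divides_mull _ _ _ _ hM); auto. }
  destruct hk as (k & hk). exists (S (length E * k)).
  set (K := S (length E * k)).
  assert (hclos : forall x, vclosure X x -> vclosure (fun y => In y E) x).
  { intros x (hx & h). split; auto. intros b t hb ht hE'. apply h; auto.
    intros y hy. apply hgen; auto. }
  assert (base : forall l, Forall (fun x => In x E) l -> length l = K -> a ∣ w ^^ K ** prod l).
  { intros l hl hlen. destruct (pigeonhole _ _ eq E k l) as (x & l1 & l2 & hx & hp & h1 & hl1).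
    - eapply Forall_impl; [|exact hl]. intros x hx. exists x. auto.
    - unfold K in hlen. lia.
    - assert (hlP : Forall P l) by (eapply Forall_impl; [|exact hl]; auto).
      rewrite (prodl_perm _ _ _ _ hM _ _ hp) by auto.
      assert (hl12 := hlP). apply (Permutation_Forall hp), Forall_app in hl12.
      destruct hl12 as (hP1 & hP2).
      assert (hlen' := Permutation_length hp). rewrite length_app, hlen, h1 in hlen'.
      rewrite hlen', (mpow_add _ _ _ _ hM), (prodl_app _ _ _ _ hM), (mulACA _ _ _ _ hM) by auto.
      apply (divides_mulr _ _ _ _ hM); auto.
      replace (prod l1) with (x ^^ k).
      + rewrite <- (mpow_op _ _ _ _ hM) by auto. auto.
      + rewrite mpow_repeat. f_equal. rewrite <- h1.
        clear - hl1. induction hl1 as [|y l1 hy hl1 IH]; simpl; congruence. }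
  (* Generators are exchanged for elements of the closure one at a time: with the other factors and
     [w^K] as multiplier, divisibility for all [y] in [E] passes to [x] by the definition of the
     closure. *)
  assert (gen : forall l2, Forall (vclosure X) l2 -> forall l1, Forall (fun x => In x E) l1 ->
            length (l1 ++ l2) = K -> a ∣ w ^^ K ** prod (l1 ++ l2)).
  { induction 1 as [|x l2 hx hl2 IH]; intros l1 hl1 hlen.
    - rewrite app_nil_r in *. auto.
    - assert (hP1 : Forall P l1) by (eapply Forall_impl; [|exact hl1]; auto).
      assert (hP2 : Forall P l2) by (eapply Forall_impl; [|exact hl2]; now intros y []).
      assert (hPx : P x) by apply hx.
      assert (hP12 : Forall P (l1 ++ l2)) by now apply Forall_app.
      rewrite (prodl_perm _ _ _ _ hM (l1 ++ x :: l2) ((l1 ++ l2) ++ x :: nil)).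
      + rewrite (prodl_app _ _ _ _ hM) by auto. simpl. rewrite (mul1r _ _ _ _ hM) by auto.
        rewrite (mulA _ _ _ _ hM) by auto. apply hclos; auto. intros y hy.
        rewrite <- (mulA _ _ _ _ hM), (mulC _ _ _ _ hM (prod (l1 ++ l2))) by auto.
        apply (IH (y :: l1)); auto.
        rewrite <- hlen. simpl. rewrite !length_app. simpl. lia.
      + rewrite <- app_assoc. apply Permutation_app_head, Permutation_cons_append.
      + apply Forall_app; auto. }
  intros l hl hlen. now apply (gen l hl nil).
Qed.

(** For [x] in the closure, the previous bound applied to [K] copies of [x] says that [a] divides
    [(w x)^K]. *)
Lemma radical_colon_vclosed a w : P a -> P w -> vclosed (radical_colon a w).
Proof.
  intros ha hw. split; [now intros x []|]. intros x hx. assert (hxP : P x) by apply hx.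
  split; auto.
  destruct (radical_colon_bounded a w (radical_colon a w)) as (K & hK); auto; [now intros y|].
  exists K. rewrite (mpow_op _ _ _ _ hM), (mpow_repeat _ _ _ x) by auto.
  apply hK; [now apply Forall_repeat|apply repeat_length].
Qed.

(** The factors are arbitrary nonidentity elements and their product need only divide [a], so the
    property is inherited by multiples of [a]. *)
Definition unbounded_divisors (a : T) : Prop :=
  P a /\ forall n, exists l, Forall (fun x => P x /\ x <> e) l /\ length l = n /\ prod l ∣ a.

Lemma radical_colon_mono a b w s :
  P b -> P w -> b ∣ a ^^ s -> subset (radical_colon a w) (radical_colon b w).
Proof.
  intros hb hw h x (hx & j & hj). split; auto. exists (s * j)%nat.
  rewrite <- (mpow_mpow _ _ _ _ hM) by auto.
  apply (divides_trans _ _ _ _ hM) with (a ^^ s); auto. now apply (divides_mpow _ _ _ _ hM).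
Qed.

(* Otherwise pick such an [a] with maximal radical and a maximal, hence prime, set
   [Q = (rad a : w)].  As [w^K Q^K] is contained in [aM], fewer than [K + 1] factors of a
   factorization of [a] lie in [Q], so [a = c z] with [c] outside [Q] having arbitrarily many
   factors.  By noetherianity a finite product [t] of such [c]'s is divisible by all of them;
   since [t] lies outside [Q], its radical is strictly larger than that of [a]. *)
Theorem no_unbounded_divisors a : ~ unbounded_divisors a.
Proof.
  intros h0.
  destruct (vclosed_maximal
    (fun X => exists b, unbounded_divisors b /\ X = radical_colon b e) (radical_colon a e))
    as (X & (b & (hb & hbad) & ->) & hmax).
  { now exists a. }
  { intros X (b & hb & ->). apply radical_colon_vclosed; auto. apply hb. }
  clear a h0. rename b into a, hb into ha.
  assert (hrad : forall x, radical_colon a e x <-> P x /\ exists j, a ∣ x ^^ j).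
  { intros x. split; intros (hx & j & hj); split; auto; exists j;
      now rewrite (mul1l _ _ _ _ hM) in *. }
  destruct (vclosed_maximal
    (fun X => exists w, P w /\ ~ radical_colon a e w /\ X = radical_colon a w)
    (radical_colon a e)) as (X & (w & hw & hwa & ->) & hmaxw).
  { exists e. split; auto. split; auto. intros h. apply hrad in h. destruct h as (_ & j & hj).
    rewrite (mpow_one _ _ _ _ hM) in hj. apply (divides_one _ _ _ _ hM) in hj. subst a.
    destruct (hbad 1%nat) as (l & hl & hlen & hdiv). apply (divides_one _ _ _ _ hM) in hdiv.
    destruct hl as [|x l [hx hne] hl]; [easy|].
    apply (mul_eq1 _ _ _ _ hM) in hdiv; [easy|auto|].
    apply prodl_P. eapply Forall_impl; [|exact hl]. now intros y []. }
  { intros X (w & hw & _ & ->). now apply radical_colon_vclosed. }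
  set (Q := radical_colon a w) in *.
  (* If [x] in [Q] divided [w^k], then [a] would divide a power of [w x], hence of [w], although [w]
     is not in the radical of [a]. *)
  assert (hQw : forall x k, Q x -> x ∣ w ^^ k -> False).
  { intros x k (hx & j & hj) hdiv. apply hwa, hrad. split; auto. exists (j * S k)%nat.
    rewrite <- (mpow_mpow _ _ _ _ hM) by auto. eapply (divides_trans _ _ _ _ hM); [exact hj|].
    apply (divides_mpow _ _ _ _ hM). simpl. apply (divides_mul _ _ _ _ hM); auto.
    now apply (divides_refl _ _ _ _ hM). }
  assert (hQe : ~ Q e).
  { intros h. apply (hQw e 0%nat h). now apply (divides_refl _ _ _ _ hM). }
  (* For [x] outside [Q], [w x] is again outside the radical, so by maximality its colon, which
     contains [Q], equals [Q]; but [x y] in [Q] puts [y] in that colon. *)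
  assert (hprime : forall x y, P x -> P y -> ~ Q x -> ~ Q y -> ~ Q (x ** y)).
  { intros x y hx hy hQx hQy (_ & j & hj). apply hQy.
    apply (hmaxw (radical_colon a (w ** x))).
    - exists (w ** x). split; auto. split; auto. intros h. apply hrad in h. apply hQx. split; auto.
      apply h.
    - intros z (hz & i & hi). split; auto. exists i.
      rewrite <- (mulA _ _ _ _ hM), (mulCA _ _ _ _ hM), (mpow_op _ _ _ _ hM) by auto.
      apply (divides_mull _ _ _ _ hM); auto.
    - split; auto. exists j. rewrite <- (mulA _ _ _ _ hM); auto. }
  destruct (radical_colon_bounded a w Q) as (K & hK); auto; [now intros x hx|].
  assert (hcut : forall n, exists l z, Forall (fun x => P x /\ x <> e) l /\ length l = n /\ P z /\
            ~ Q (prod l) /\ a = prod l ** z).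
  { intros n. destruct (hbad (n + K)%nat) as (l & hl & hlen & _ & _ & r & hr & Ea).
    destruct (partition_classical _ Q l) as (l1 & l2 & hp & h1 & h2).
    assert (hlP : Forall P l) by (eapply Forall_impl; [|exact hl]; now intros y []).
    assert (hlP12 := hlP). apply (Permutation_Forall hp), Forall_app in hlP12.
    destruct hlP12 as (hP1 & hP2).
    rewrite (prodl_perm _ _ _ _ hM _ _ hp) in Ea by auto.
    (* With [K + 1] factors in [Q], let [f] be the first [K] and [z] the next. As [a] divides
       [w^K prod f], cancelling [prod f] shows that [z] divides [w^K], which [hQw] forbids. *)
    assert (hlen1 : (length l1 <= K)%nat).
    { apply Nat.nlt_ge. intros hlt.
      assert (hsplit := firstn_skipn K l1).
      assert (hf : length (firstn K l1) = K) by (apply firstn_length_le; lia).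
      destruct (skipn K l1) as [|z rest] eqn:Es.
      { apply (f_equal (@length T)) in hsplit. rewrite length_app, hf in hsplit. simpl in hsplit. lia. }
      set (f := firstn K l1) in *. clearbody f. subst l1.
      apply Forall_app in h1, hP1. destruct h1 as (hQf & hQz), hP1 as (hPf & hPz).
      inversion hQz; inversion hPz; subst.
      destruct (hK f) as (_ & _ & u & hu & Eu); auto.
      { eapply Forall_impl; [|exact hQf]. intros x hx. split; [apply hx|auto]. }
      apply (hQw z (length f)); auto.
      rewrite <- app_assoc, (prodl_app _ _ _ _ hM) in Eu by (auto; apply Forall_app; auto).
      simpl in Eu. assert (P (prod (rest ++ l2))) by (apply prodl_P, Forall_app; auto).
      rewrite (mulC _ _ _ _ hM (w ^^ _)), <- !(mulA _ _ _ _ hM) in Eu by auto.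
      apply hcan in Eu; auto. rewrite Eu. apply (divides_intro _ _ _ _ hM); auto. }
    assert (hlen2 := Permutation_length hp). rewrite length_app in hlen2.
    assert (hn2 : (n <= length l2)%nat) by lia.
    assert (hl2 : Forall (fun x => P x /\ x <> e) l2).
    { apply (Permutation_Forall hp), Forall_app in hl. apply hl. }
    rewrite <- (firstn_skipn n l2) in hl2, h2, hP2, Ea.
    assert (hlenf : length (firstn n l2) = n) by now apply firstn_length_le.
    set (f := firstn n l2) in *. set (g := skipn n l2) in *. clearbody f g.
    apply Forall_app in hl2, h2, hP2. destruct hl2 as [hl2 _], h2 as [h2 _], hP2 as [hPf hPg].
    exists f, (prod l1 ** prod g ** r). repeat (split; [now auto|]). split.
    - clear - h2 hPf hQe hprime prodl_P. induction h2 as [|x f hx h2 IH]; simpl; auto.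
      inversion hPf; subst. auto.
    - rewrite Ea, !(prodl_app _ _ _ _ hM) by (auto; apply Forall_app; auto).
      rewrite (mulCA _ _ _ _ hM (prod l1)), <- (mulA _ _ _ _ hM) by auto. reflexivity. }
  (* Finite generation is applied to the cofactors [z] of [a = c z]: divisibility of [t z] by [a]
     passes from the generators to all [z], and cancelling [z] then gives that [c] divides [t]. *)
  destruct (hfg (fun z => P z /\ exists c, P c /\ ~ Q c /\ a = c ** z)) as (E & hE & hgen).
  { now intros z []. }
  assert (ht : exists t, P t /\ ~ Q t /\ (exists s, t ∣ a ^^ s) /\ forall z, In z E -> a ∣ t ** z).
  { clear hgen. induction hE as [|z E (hz & c & hc & hQc & Ec) hE (t & ht & hQt & (s & hs) & hEt)].
    - exists e. split; auto. split; auto. split; [|easy].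
      exists 0%nat. now apply (divides_refl _ _ _ _ hM).
    - exists (c ** t). split; auto. split; auto. split.
      + exists (S s). apply (divides_mul _ _ _ _ hM); auto. rewrite Ec.
        now apply (divides_intro _ _ _ _ hM).
      + assert (hEP : forall y, In y E -> P y).
        { rewrite Forall_forall in hE. intros y hy. now apply hE. }
        intros y [<-|hy].
        * rewrite (mulC _ _ _ _ hM c), <- (mulA _ _ _ _ hM), <- Ec by auto.
          apply (divides_mull _ _ _ _ hM); auto. now apply (divides_refl _ _ _ _ hM).
        * rewrite <- (mulA _ _ _ _ hM) by auto. apply (divides_mull _ _ _ _ hM); auto. }
  destruct ht as (t & ht & hQt & (s & hs) & hEt).
  apply hQt. assert (h : radical_colon a e t).
  { apply (hmax (radical_colon t e)).
    - exists t. split; auto. split; auto. intros n.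
      destruct (hcut n) as (l & z & hl & hlen & hz & hQl & Ea).
      assert (hlP : Forall P l) by (eapply Forall_impl; [|exact hl]; now intros y []).
      exists l. split; auto. split; auto.
      assert (hdiv : a ∣ t ** z).
      { apply hgen; auto. split; auto. exists (prod l). auto. }
      destruct hdiv as (_ & _ & u & hu & Eu). split; auto. split; auto. exists u. split; auto.
      apply (hcan z); auto. rewrite (mulC _ _ _ _ hM), Eu, Ea by auto.
      rewrite (mulC _ _ _ _ hM (prod l)), (mulA _ _ _ _ hM) by auto. reflexivity.
    - now apply radical_colon_mono with s.
    - split; auto. exists 1%nat. simpl.
      rewrite (mul1l _ _ _ _ hM), (mul1r _ _ _ _ hM) by auto. now apply (divides_refl _ _ _ _ hM). }
  apply hrad in h. destruct h as (_ & j & hj). split; auto. exists j.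
  rewrite (mpow_op _ _ _ _ hM) by auto. apply (divides_mull _ _ _ _ hM); auto.
Qed.

Theorem bounded_lengths a : P a -> exists B, forall n, L a n -> (n <= B)%nat.
Proof.
  intros ha. apply NNPP. intros h. apply (no_unbounded_divisors a). split; auto. intros n.
  assert (hex : exists m, L a m /\ (n < m)%nat).
  { apply NNPP. intros h'. apply h. exists n. intros m hm. apply Nat.nlt_ge. eauto. }
  destruct hex as (m & hm & hlt). apply (lengths_iff _ _ _ _ hM) in hm.
  destruct hm as (us & hus & <- & ->).
  rewrite <- (firstn_skipn n us) in *.
  assert (hlen : length (firstn n us) = n).
  { apply firstn_length_le. rewrite firstn_skipn in hlt. lia. }
  apply Forall_app in hus. destruct hus as (h1 & h2).
  exists (firstn n us). split; [|split; auto].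
  - eapply Forall_impl; [|exact h1]. intros u hu. split; auto. now apply (atom_neq1 _ _ _ _ hM).
  - rewrite (prodl_app _ _ _ _ hM) by auto. now apply (divides_intro _ _ _ _ hM); auto.
Qed.

End Noetherian.

(** * Monoids of r-ideals *)

Lemma set_ext (A : Type) (X Y : A -> Prop) : subset X Y -> subset Y X -> X = Y.
Proof.
  intros h1 h2. apply functional_extensionality. intros x.
  apply propositional_extensionality. split; auto.
Qed.

Lemma subset_trans (A : Type) (X Y Z : A -> Prop) : subset X Y -> subset Y Z -> subset X Z.
Proof. intros h1 h2 x hx. auto. Qed.

Lemma subset_refl (A : Type) (X : A -> Prop) : subset X X.
Proof. intros x hx. auto. Qed.

(** * Calculus of an ideal system and invertible ideals *)

Section Ideals.
Context (G : CGroup) (H : G -> Prop) (hH : quotient_group_of H).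
Context (r : (G -> Prop) -> G -> Prop) (hr : ideal_system H r).
Local Infix "⋅" := setmul (at level 40, left associativity).
Local Infix "⊆" := subset (at level 70).
Local Hint Resolve subset_refl : core.

Lemma setmul_comm (X Y : G -> Prop) : X ⋅ Y = Y ⋅ X.
Proof.
  apply set_ext; intros g (x & y & hx & hy & ->); exists y, x; repeat split; auto; apply gmulC.
Qed.

Lemma setmul_assoc (X Y Z : G -> Prop) : X ⋅ (Y ⋅ Z) = X ⋅ Y ⋅ Z.
Proof.
  apply set_ext.
  - intros g (x & w & hx & (y & z & hy & hz & ->) & ->). exists (gmul x y), z.
    rewrite gmulA. repeat split; auto. now exists x, y.
  - intros g (w & z & (x & y & hx & hy & ->) & hz & ->). exists x, (gmul y z).
    rewrite gmulA. repeat split; auto. now exists y, z.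
Qed.

Lemma setmul_ACA (X Y Z W : G -> Prop) : (X ⋅ Y) ⋅ (Z ⋅ W) = (X ⋅ Z) ⋅ (Y ⋅ W).
Proof.
  now rewrite <- !setmul_assoc, (setmul_assoc Y), (setmul_comm Y Z), <- setmul_assoc.
Qed.

Lemma setmul_mono (X X' Y Y' : G -> Prop) : X ⊆ X' -> Y ⊆ Y' -> X ⋅ Y ⊆ X' ⋅ Y'.
Proof. intros hX hY g (x & y & hx & hy & ->). exists x, y. auto. Qed.

Lemma smul_smul (a b : G) X : smul a (smul b X) = smul (gmul a b) X.
Proof.
  unfold smul. rewrite setmul_assoc. f_equal. apply set_ext.
  - intros g (x & y & -> & -> & ->). reflexivity.
  - intros g ->. now exists a, b.
Qed.

Lemma smul_one (X : G -> Prop) : smul gone X = X.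
Proof.
  apply set_ext.
  - intros g (x & y & -> & hy & ->). now rewrite gmul1.
  - intros g hg. exists gone, g. rewrite gmul1. repeat split; auto.
Qed.

Lemma smul_inv_l (a : G) X : smul (ginv a) (smul a X) = X.
Proof. now rewrite smul_smul, gmulV, smul_one. Qed.

Lemma smul_inv_r (a : G) X : smul a (smul (ginv a) X) = X.
Proof. now rewrite smul_smul, gmulC, gmulV, smul_one. Qed.

Lemma smul_mono (a : G) X Y : X ⊆ Y -> smul a X ⊆ smul a Y.
Proof. intros h. now apply setmul_mono. Qed.

Lemma smul_subset_inv (a : G) X Y : smul a X ⊆ smul a Y -> X ⊆ Y.
Proof. intros h. apply (smul_mono (ginv a)) in h. now rewrite !smul_inv_l in h. Qed.

Lemma smul_inj (a : G) X Y : smul a X = smul a Y -> X = Y.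
Proof. intros h. apply (f_equal (smul (ginv a))) in h. now rewrite !smul_inv_l in h. Qed.

Lemma smul_setmul_l (a : G) X Y : smul a X ⋅ Y = smul a (X ⋅ Y).
Proof. unfold smul. now rewrite setmul_assoc. Qed.

Lemma smul_setmul_r (a : G) X Y : X ⋅ smul a Y = smul a (X ⋅ Y).
Proof. now rewrite setmul_comm, smul_setmul_l, setmul_comm. Qed.

Lemma setmul_sub X Y : X ⊆ H -> Y ⊆ H -> X ⋅ Y ⊆ H.
Proof. intros hX hY g (x & y & hx & hy & ->). apply hH; auto. Qed.

Lemma smul_sub a X : H a -> X ⊆ H -> smul a X ⊆ H.
Proof. intros ha hX. apply setmul_sub; auto. now intros g ->. Qed.

Lemma r_sub X : X ⊆ H -> r X ⊆ H.
Proof. apply hr. Qed.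

Lemma r_incl X : X ⊆ H -> X ⊆ r X.
Proof. apply hr. Qed.

Lemma r_min X Y : X ⊆ H -> Y ⊆ H -> X ⊆ r Y -> r X ⊆ r Y.
Proof. apply hr. Qed.

Lemma r_smul a X : H a -> X ⊆ H -> smul a (r X) = r (smul a X).
Proof. apply hr. Qed.
Local Hint Resolve setmul_sub smul_sub r_sub r_incl : core.

Lemma r_mono X Y : Y ⊆ H -> X ⊆ Y -> r X ⊆ r Y.
Proof.
  intros hY h. apply r_min; auto.
  - now apply subset_trans with Y.
  - apply subset_trans with Y; auto.
Qed.

Lemma r_idem X : X ⊆ H -> r (r X) = r X.
Proof. intros h. apply set_ext; auto. apply r_min; auto. Qed.

(** For each [x] in [X], the translation axiom gives [x (r Y) = r (x Y)], which lies in [r (X Y)].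
    Associativity of [r]-multiplication rests on this. *)
Lemma r_setmul_r X Y : X ⊆ H -> Y ⊆ H -> r (X ⋅ r Y) = r (X ⋅ Y).
Proof.
  intros hX hY. apply set_ext.
  - apply r_min; auto. intros g (x & y & hx & hy & ->).
    assert (h : smul x (r Y) (gmul x y)) by (now exists x, y).
    rewrite r_smul in h; auto. revert h. apply r_mono; auto.
    apply setmul_mono; auto. now intros z ->.
  - apply r_mono; auto. apply setmul_mono; auto.
Qed.

Lemma r_setmul_l X Y : X ⊆ H -> Y ⊆ H -> r (r X ⋅ Y) = r (X ⋅ Y).
Proof. intros hX hY. now rewrite setmul_comm, r_setmul_r, setmul_comm. Qed.

Lemma r_setmul_rr X Y : X ⊆ H -> Y ⊆ H -> r (r X ⋅ r Y) = r (X ⋅ Y).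
Proof. intros hX hY. now rewrite r_setmul_r, r_setmul_l by auto. Qed.

Lemma r_full : r H = H.
Proof. apply set_ext; auto. Qed.

Lemma r_sing_one : r (sing gone) = H.
Proof.
  assert (h1 : H gone) by apply hH.
  apply set_ext.
  - apply r_sub. now intros g ->.
  - rewrite <- (smul_one H) at 1. now apply hr.
Qed.

Lemma r_ideal_absorb I X : r_ideal H r I -> X ⊆ H -> I ⋅ X ⊆ I.
Proof.
  intros (hI & hrI) hX g (x & y & hx & hy & ->).
  assert (hg : smul x H (gmul x y)) by (exists x, y; repeat split; auto).
  apply hr in hg; auto. rewrite <- hrI. revert hg. apply r_mono; auto. now intros z ->.
Qed.

Lemma r_setmul_sub I X : r_ideal H r I -> X ⊆ H -> r (I ⋅ X) ⊆ I.
Proof.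
  intros hI hX. destruct (hI) as (h1 & h2). rewrite <- h2 at 2. apply r_mono; auto.
  now apply r_ideal_absorb.
Qed.

Lemma r_full_setmul I : r_ideal H r I -> r (H ⋅ I) = I.
Proof.
  intros hI. assert (h1 : H gone) by apply hH. apply set_ext.
  - rewrite setmul_comm. apply r_setmul_sub; auto.
  - destruct hI as (hI & hrI). rewrite <- hrI at 1. apply r_mono; auto.
    intros g hg. exists gone, g. rewrite gmul1. auto.
Qed.

Lemma r_ideal_r X : X ⊆ H -> r_ideal H r (r X).
Proof. intros h. split; auto. now apply r_idem. Qed.

Lemma nonempty_setmul (X Y : G -> Prop) : nonempty X -> nonempty Y -> nonempty (X ⋅ Y).
Proof. intros (x & hx) (y & hy). exists (gmul x y), x, y. auto. Qed.

Lemma nonempty_mono (X Y : G -> Prop) : X ⊆ Y -> nonempty X -> nonempty Y.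
Proof. intros h (x & hx). exists x. auto. Qed.

Lemma Ir_sub I : Ir H r I -> I ⊆ H.
Proof. now intros ((h & _) & _). Qed.

Lemma Ir_r I : Ir H r I -> r I = I.
Proof. now intros ((_ & h) & _). Qed.
Local Hint Resolve Ir_sub : core.

Lemma Ir_rmul I J : Ir H r I -> Ir H r J -> Ir H r (rmul r I J).
Proof.
  intros hI hJ. split; [apply r_ideal_r; auto|].
  apply nonempty_mono with (I ⋅ J); auto.
  apply nonempty_setmul; [apply hI|apply hJ].
Qed.

Lemma Ir_full : Ir H r H.
Proof. split; [split; auto using r_full|]. exists gone. apply hH. Qed.

Lemma Ir_monoid : reduced_cmonoid (G -> Prop) (Ir H r) (rmul r) H.
Proof.
  split; unfold rmul.
  - apply Ir_full.
  - apply Ir_rmul.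
  - intros A B C hA hB hC. rewrite r_setmul_r, r_setmul_l, setmul_assoc by auto. reflexivity.
  - intros A B _ _. now rewrite setmul_comm.
  - intros A (hA & _). now apply r_full_setmul.
  - intros A B hA hB E. apply set_ext; auto. rewrite <- E. apply r_setmul_sub; auto. apply hA.
Qed.

(* [r]-invertibility with denominators cleared: replace the fractional inverse [J] by [dJ]. *)
Definition integrally_invertible (I : G -> Prop) : Prop :=
  exists J d, J ⊆ H /\ H d /\ r (I ⋅ J) = smul d H.

(** [rfrac] collects all admissible denominators; multiplying by [c c'] shows that any two of them
    give the same set. *)
Lemma rfrac_eq X c : H c -> smul c X ⊆ H -> rfrac H r X = smul (ginv c) (r (smul c X)).
Proof.
  intros hc hX. apply set_ext; [|intros g hg; exists c; auto].
  assert (key : forall a b, H a -> H b -> smul b X ⊆ H ->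
    smul (gmul a b) (smul (ginv b) (r (smul b X))) = r (smul (gmul a b) X)).
  { intros a b ha hb hbX. now rewrite <- !smul_smul, smul_inv_r, r_smul by auto. }
  intros g (c' & hc' & hX' & hg). revert g hg. apply (smul_subset_inv (gmul c c')).
  rewrite key by auto. rewrite (gmulC c c'), key by auto. auto.
Qed.

Lemma Irstar_iff I : Irstar H r I <-> Ir H r I /\ integrally_invertible I.
Proof.
  unfold Irstar, r_invertible. split; intros (hI & h); split; auto.
  - destruct h as (J & (c & hc & hcJ) & _ & hIJ). exists (smul c J), c. split; auto. split; auto.
    assert (h : smul c (I ⋅ J) ⊆ H) by (rewrite <- smul_setmul_r; auto).
    rewrite (rfrac_eq _ c), <- smul_setmul_r in hIJ by auto.
    now rewrite <- hIJ, smul_inv_r.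
  - destruct h as (J & d & hJ & hd & hIJ). exists (smul (ginv d) (r J)).
    split; [|split].
    + exists d. rewrite smul_inv_r. auto.
    + rewrite (rfrac_eq _ d) by (rewrite ?smul_inv_r; auto). now rewrite smul_inv_r, r_idem.
    + rewrite smul_setmul_r.
      rewrite (rfrac_eq _ d) by (rewrite ?smul_inv_r; auto).
      rewrite smul_inv_r, r_setmul_r, hIJ, smul_inv_l by auto. reflexivity.
Qed.

Lemma Irstar_Ir I : Irstar H r I -> Ir H r I.
Proof. now intros (h & _). Qed.
Local Hint Resolve Irstar_Ir : core.

(** Multiplying [r (I X)] by [J] and closing gives [d X] for every [r]-ideal [X], and [d] cancels in
    the group. *)
Lemma invertible_cancel_sub I A B :
  I ⊆ H -> integrally_invertible I -> r_ideal H r A -> r_ideal H r B ->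
  r (I ⋅ A) ⊆ r (I ⋅ B) -> A ⊆ B.
Proof.
  intros hI (J & d & hJ & hd & hIJ) hA hB h.
  assert (key : forall X, r_ideal H r X -> r (J ⋅ r (I ⋅ X)) = smul d X).
  { intros X hX. assert (hXH : X ⊆ H) by apply hX.
    rewrite r_setmul_r, setmul_assoc, <- r_setmul_l by auto.
    rewrite (setmul_comm J), hIJ, smul_setmul_l, <- r_smul, r_full_setmul by auto. reflexivity. }
  apply (smul_subset_inv d). rewrite <- !key by auto.
  assert (A ⊆ H) by apply hA. assert (B ⊆ H) by apply hB.
  apply r_mono; auto. apply setmul_mono; auto.
Qed.

Lemma invertible_cancel I A B :
  I ⊆ H -> integrally_invertible I -> Ir H r A -> Ir H r B ->
  rmul r I A = rmul r I B -> A = B.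
Proof.
  unfold rmul. intros hI hinv (hA & _) (hB & _) E.
  apply set_ext; apply (invertible_cancel_sub I); auto; rewrite E; auto.
Qed.

(** To contain is to divide when [A] is invertible: the quotient is [B] times the inverse of [A],
    and it lies in [H] because [B J] is contained in [A J]. *)
Lemma invertible_quotient A B :
  Ir H r A -> integrally_invertible A -> Ir H r B -> B ⊆ A ->
  exists C, Ir H r C /\ B = rmul r A C /\ (integrally_invertible B -> integrally_invertible C).
Proof.
  intros hA (J & d & hJ & hd & hAJ) hB hBA. set (C := smul (ginv d) (r (B ⋅ J))).
  assert (hdC : smul d C = r (B ⋅ J)) by apply smul_inv_r.
  assert (hCH : C ⊆ H).
  { apply (smul_subset_inv d). rewrite hdC, <- hAJ. apply r_mono; auto.
    apply setmul_mono; auto. }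
  assert (hAC : r (A ⋅ C) = B).
  { apply (smul_inj d). rewrite r_smul, <- smul_setmul_r, hdC, r_setmul_r by auto.
    rewrite setmul_assoc, (setmul_comm A), <- setmul_assoc, <- r_setmul_r, hAJ by auto.
    rewrite smul_setmul_r, <- r_smul, (setmul_comm B), r_full_setmul by (auto; apply hB).
    reflexivity. }
  exists C. split; [|split].
  - split; [split; auto|].
    + apply (smul_inj d). rewrite r_smul, hdC, r_idem by auto. reflexivity.
    (* An ideal system may close the empty set to a nonempty one, so nonemptiness is shown for [r J]
       rather than [J]. *)
    + assert (hne : nonempty (r (B ⋅ r J))).
      { assert (hrJ : nonempty (r J)).
        { assert (h : nonempty (smul d H)).
          { apply nonempty_setmul; [now exists d|]. exists gone. apply hH. }
          rewrite <- hAJ in h. revert h. apply nonempty_mono.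
          rewrite <- (r_idem J) by auto. apply r_mono; auto.
          rewrite setmul_comm. apply subset_trans with (r J ⋅ A).
          - apply setmul_mono; auto.
          - apply r_ideal_absorb; auto. now apply r_ideal_r. }
        apply nonempty_mono with (B ⋅ r J); auto. apply nonempty_setmul; auto. apply hB. }
      rewrite r_setmul_r in hne by auto. destruct hne as (g & hg).
      exists (gmul (ginv d) g), (ginv d), g. now repeat split.
  - now symmetry.
  - intros (K & f & hK & hf & hBK). exists (A ⋅ K), f. split; auto. split; auto.
    rewrite setmul_assoc, (setmul_comm C), <- r_setmul_l, hAC by auto. exact hBK.
Qed.

Lemma divides_subset P A B :
  (forall I, P I -> Ir H r I) -> divides P (rmul r) A B -> B ⊆ A.
Proof.
  intros hP (hA & hB & C & hC & ->). apply r_setmul_sub; auto. now apply hP.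
Qed.

Lemma Irstar_monoid : reduced_cmonoid (G -> Prop) (Irstar H r) (rmul r) H.
Proof.
  destruct Ir_monoid as [h1 h2 h3 h4 h5 h6].
  split; auto.
  - apply Irstar_iff. split; auto. assert (h : H gone) by apply hH.
    exists H, gone. rewrite smul_one. repeat split; auto. apply r_full_setmul, Ir_full.
  - intros A B hA hB. apply Irstar_iff in hA, hB. apply Irstar_iff.
    destruct hA as (hA & J & d & hJ & hd & hAJ), hB as (hB & K & f & hK & hf & hBK).
    split; auto. exists (J ⋅ K), (gmul d f). split; auto. split; [now apply hH|].
    unfold rmul. rewrite r_setmul_l, setmul_ACA, <- r_setmul_rr, hAJ, hBK by auto.
    rewrite smul_setmul_l, smul_setmul_r, smul_smul, <- r_smul, r_full_setmul; auto.
    + apply Ir_full.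
    + now apply hH.
  - intros A B hA hB. apply h6; auto.
Qed.

Lemma Irstar_cancel I A B :
  Irstar H r I -> Irstar H r A -> Irstar H r B -> rmul r I A = rmul r I B -> A = B.
Proof.
  intros hI hA hB. apply invertible_cancel; auto. now apply Irstar_iff.
Qed.

Lemma Irstar_divides A B :
  Irstar H r A -> Irstar H r B -> B ⊆ A -> divides (Irstar H r) (rmul r) A B.
Proof.
  intros hA hB hBA. do 2 (split; auto). rewrite Irstar_iff in hA, hB.
  destruct (invertible_quotient A B) as (C & hC & E & hinv); try easy.
  exists C. split; auto. apply Irstar_iff. split; auto. now apply hinv.
Qed.

(** * Consequences of the ascending chain condition on r-ideals *)

Section RNoetherian.
Context (hnoeth : r_noetherian H r).

(** Otherwise, adjoining again and again a member of [F] not inside the closure reached so far gives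
    a strictly ascending chain of [r]-ideals. *)
Lemma r_noetherian_finite (F : (G -> Prop) -> Prop) :
  (forall X, F X -> X ⊆ H) ->
  exists E, Forall F E /\ forall X, F X -> X ⊆ r (fun g => exists Y, In Y E /\ Y g).
Proof.
  intros hF. apply NNPP. intros hno. set (U := fun (E : list (G -> Prop)) g => exists Y, In Y E /\ Y g).
  assert (hU : forall E, Forall F E -> U E ⊆ H).
  { intros E hE g (Y & hY & hg). rewrite Forall_forall in hE. now apply (hF Y); auto. }
  destruct (dependent_choice _ (Forall F)
    (fun E E' => U E ⊆ U E' /\ ~ U E' ⊆ r (U E)) nil) as (f & _ & hf & hR); auto.
  { intros E hE. assert (hex : exists X, F X /\ ~ X ⊆ r (U E)).
    { apply NNPP. intros h. apply hno. exists E. split; auto. intros X hX. apply NNPP. eauto. }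
    destruct hex as (X & hX & hXE). exists (X :: E). split; auto. split.
    - intros g (Y & hY & hg). exists Y. split; auto. now right.
    - intros h. apply hXE. intros g hg. apply h. exists X. split; auto. now left. }
  destruct (hnoeth (fun n => r (U (f n)))) as (N & hN).
  - intros n. apply r_ideal_r. auto.
  - intros n. apply r_mono; [auto|apply hR].
  - apply (hR N). rewrite <- (hN (S N)) by lia. auto.
Qed.

Lemma in_maximal_r_ideal I :
  r_ideal H r I -> I <> H -> exists M, maximal_r_ideal H r M /\ I ⊆ M.
Proof.
  intros hI hne. apply NNPP. intros hno.
  destruct (dependent_choice _ (fun J => r_ideal H r J /\ J <> H /\ I ⊆ J)
    (fun J K => J ⊆ K /\ K <> J) I) as (f & _ & hf & hR); auto.
  { intros J (hJ & hJH & hIJ). apply NNPP. intros h. apply hno. exists J. split; auto.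
    split; auto. split; auto. intros K hK hKH hJK. apply NNPP. intros hKJ. apply h.
    exists K. repeat split; auto; try apply hK. now apply subset_trans with J. }
  destruct (hnoeth f) as (N & hN).
  - intros n. apply hf.
  - intros n. apply hR.
  - destruct (hR N) as (_ & h). apply h, hN. lia.
Qed.

(** If [A] divides [B Y] for all [Y] in [E], then [A] contains [B] times the closure of their union,
    hence [B I]; between invertible ideals this inclusion is divisibility. *)
Lemma Irstar_finite X :
  subset X (Irstar H r) ->
  exists E, Forall X E /\
    forall I, X I -> vclosure _ (Irstar H r) (rmul r) (fun J => In J E) I.
Proof.
  intros hX. destruct (r_noetherian_finite X) as (E & hE & hgen); [auto|].
  exists E. split; auto. intros I hI. split; auto. intros A B hA hB hdiv.
  apply Irstar_divides; auto.
  - apply (rcm_mul _ _ _ _ Irstar_monoid); auto.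
  - assert (hEH : (fun g => exists Y, In Y E /\ Y g) ⊆ H).
    { intros g (Y & hY & hg). rewrite Forall_forall in hE. assert (hYH : Y ⊆ H) by auto. now apply hYH. }
    unfold rmul. apply subset_trans with (r (B ⋅ r (fun g => exists Y, In Y E /\ Y g))).
    + apply r_mono; auto. apply setmul_mono; auto.
    + rewrite r_setmul_r by auto. rewrite <- (Ir_r A) by auto. apply r_mono; auto.
      intros g (x & y & hx & (Y & hY & hy) & ->).
      assert (hYH : Y ⊆ H) by (intros z hz; apply hEH; eauto).
      apply (divides_subset (Irstar H r) A (rmul r B Y)); auto.
      apply r_incl; auto. now exists x, y.
Qed.

Lemma prodl_sub_setpow M l :
  M ⊆ H -> Forall (fun I => Ir H r I /\ I ⊆ M) l -> prodl (rmul r) H l ⊆ r (setpow M (length l)).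
Proof.
  intros hM. assert (hpow : forall n, setpow M n ⊆ H).
  { intros n. induction n; simpl; auto. intros g ->. apply hH. }
  induction 1 as [|I l (hI & hIM) hl IH]; simpl.
  - rewrite r_sing_one. auto.
  - rewrite <- r_setmul_r by auto. apply r_mono; auto. apply setmul_mono; auto.
Qed.

Lemma r_setpow_antitone M m n : M ⊆ H -> (m <= n)%nat -> r (setpow M n) ⊆ r (setpow M m).
Proof.
  intros hM. assert (hpow : forall n, setpow M n ⊆ H).
  { intros k. induction k; simpl; auto. intros g ->. apply hH. }
  induction 1 as [|n hmn IH]; auto. apply subset_trans with (r (setpow M n)); auto. simpl.
  rewrite setmul_comm, <- r_setmul_l by auto. apply r_setmul_sub; auto. now apply r_ideal_r.
Qed.

(* A factorization of [I] with more than [|l| N] factors has [N] of them inside one of the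
   finitely many maximal [r]-ideals [M] containing a fixed element of [I], so [I] lies in
   [(M^N)_r]. *)
Lemma Ir_bounded_lengths :
  finite_r_character H r -> r_Krull_intersection H r ->
  forall I, Ir H r I -> exists B, forall n, lengths (Ir H r) (rmul r) H I n -> (n <= B)%nat.
Proof.
  intros hfin hkrull I hI. destruct (hI) as (_ & a & ha).
  destruct (hfin a) as (l & hl); [now apply (Ir_sub I)|].
  set (R := fun (J M : G -> Prop) => J ⊆ M /\ maximal_r_ideal H r M /\ M a).
  (* The exponents given by the Krull property are summed over [l], which may also contain sets that
     are not maximal ideals. With [N] positive, the pigeonhole yields at least one factor, whose
     relation to [M] certifies that [M] is maximal and contains [a]. *)
  assert (hN : exists N, (0 < N)%nat /\ forall M, In M l -> maximal_r_ideal H r M -> M a -> ~ r (setpow M N) a).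
  { clear hl. induction l as [|M l (N & N0 & hN)].
    { exists 1%nat. split; [lia|]. now intros M []. }
    assert (hM : exists n, maximal_r_ideal H r M -> M a -> ~ r (setpow M n) a).
    { destruct (classic (maximal_r_ideal H r M /\ M a)) as [(hmax & hMa)|h].
      - destruct hmax as (hM & hMH & _). assert (hIr : Ir H r M) by (split; auto; now exists a).
        assert (hk := hkrull M hIr hMH a). apply NNPP. intros hno. apply hk. intros n.
        apply NNPP. intros hn. apply hno. exists n. auto.
      - exists 0%nat. intros h1 h2. now destruct h. }
    destruct hM as (n & hn). exists (n + N)%nat. split; [lia|]. intros M' hin hmax hMa h.
    assert (hMH : M' ⊆ H) by apply hmax.
    destruct hin as [<-|hin].
    - apply hn; auto. revert h. apply r_setpow_antitone; auto. lia.
    - apply (hN M'); auto. revert h. apply r_setpow_antitone; auto. lia. }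
  destruct hN as (N & N0 & hN). exists (length l * N)%nat. intros n hn.
  apply (lengths_iff _ _ _ _ Ir_monoid) in hn. destruct hn as (us & hus & <- & E).
  apply Nat.nlt_ge. intros hlt.
  assert (husP := Forall_atom_P _ _ _ _ _ hus).
  destruct (pigeonhole _ _ R l N us) as (M & l1 & l2 & hM & hp & hlen & hR); auto.
  - rewrite Forall_forall in *. intros u hu.
    destruct (in_maximal_r_ideal u) as (M & hM & huM).
    + apply husP, hu.
    + apply (atom_neq1 _ _ _ _ Ir_monoid). auto.
    + assert (hMa : M a).
      { apply huM. revert a ha hl R hN.
        cut (I ⊆ u); [auto|]. apply (divides_subset (Ir H r)); auto. rewrite E.
        apply (divides_prodl _ _ _ _ Ir_monoid); auto. now apply Forall_forall. }
      exists M. split; [|split]; auto.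
  - assert (hP := husP). apply (Permutation_Forall hp), Forall_app in hP. destruct hP as (h1 & h2).
    assert (hmax : maximal_r_ideal H r M /\ M a).
    { destruct l1 as [|J l1]; simpl in hlen; [lia|]. inversion hR as [|? ? (_ & h)]. exact h. }
    destruct hmax as (hmax & hMa). apply (hN M); auto. rewrite <- hlen.
    assert (hsub : I ⊆ prodl (rmul r) H l1).
    { rewrite E, (prodl_perm _ _ _ _ Ir_monoid _ _ hp), (prodl_app _ _ _ _ Ir_monoid) by auto.
      apply r_setmul_sub.
      - now apply (prodl_P _ _ _ _ Ir_monoid).
      - now apply Ir_sub, (prodl_P _ _ _ _ Ir_monoid). }
    apply hsub in ha. revert ha. apply prodl_sub_setpow; [apply hmax|].
    rewrite Forall_forall in *. intros J hJ. split; [now apply h1|now apply hR].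
Qed.

End RNoetherian.

(** Invertibility turns inclusion in [P] into divisibility by [P]. If [x] in [I] is outside [P],
    then [x y] in [P] forces every [y] of [J] into [P]. *)
Lemma prime_r_ideal_is_prime P :
  prime_r_ideal H r P -> r_invertible H r P -> is_prime (Ir H r) (rmul r) H P.
Proof.
  intros (hP & hne & hprime) hinv. apply Irstar_iff in hinv. destruct hinv as (hIr & hinv).
  assert (hdiv : forall I, Ir H r I -> I ⊆ P -> divides (Ir H r) (rmul r) P I).
  { intros I hI hIP. destruct (invertible_quotient P I) as (C & hC & E & _); auto.
    do 2 (split; auto). exists C. auto. }
  split; auto. split.
  - now rewrite (is_unit_iff _ _ _ _ Ir_monoid).
  - intros I J hI hJ h. apply divides_subset in h; auto.
    destruct (classic (I ⊆ P)) as [hIP|hIP]; [left; auto|].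
    right. apply hdiv; auto. intros y hy. apply NNPP. intros hyP. apply hIP. intros x hx.
    destruct (hprime x y); try easy.
    + now apply (Ir_sub I).
    + now apply (Ir_sub J).
    + apply h. apply r_incl; auto. now exists x, y.
Qed.

End Ideals.

Theorem theorem4p1 (G : CGroup) (H : G -> Prop) (hH : quotient_group_of H)
  (r : (G -> Prop) -> (G -> Prop)) (hr : ideal_system H r)
  (hnoeth : r_noetherian H r) :
  ( (exists p, is_prime (Irstar H r) (rmul r) H p) ->
    (accepted_elasticity (Irstar H r) (rmul r) H \/ locally_fg (Irstar H r) (rmul r) H) ->
    fully_elastic (Irstar H r) (rmul r) H )
  /\
  ( finite_r_character H r -> r_Krull_intersection H r ->
    (exists P, prime_r_ideal H r P /\ r_invertible H r P) ->
    (accepted_elasticity (Ir H r) (rmul r) H \/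
     (forall a, Ir H r a -> accepted_elasticity (dc_sub (Ir H r) (rmul r) H a) (rmul r) H)) ->
    fully_elastic (Ir H r) (rmul r) H ).
Proof.
  assert (hM := Irstar_monoid G H hH r hr). assert (hI := Ir_monoid G H hH r hr).
  assert (hcan := Irstar_cancel G H hH r hr).
  split.
  - intros (p & hp) [hacc|hfg].
    + apply (fully_elastic_of_accepted _ _ _ _ hM p); auto.
      * intros X Y. apply hcan, hp.
      * apply (bounded_lengths _ _ _ _ hM hcan). now apply Irstar_finite.
    + now apply (fully_elastic_of_locally_fg _ _ _ _ hM hcan p).
  - intros hfin hkrull (P & hP & hinv) hacc.
    apply (fully_elastic_of_accepted _ _ _ _ hI P); auto.
    + now apply prime_r_ideal_is_prime.
    + apply Irstar_iff in hinv; auto. destruct hinv as (hPI & hinv).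
      intros X Y. apply (invertible_cancel G H hH r hr); auto. apply hPI.
    + now apply Ir_bounded_lengths.
Qed.
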